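(* Let $k$ be an algebraically closed field of characteristic $p>0$ and let $G$ be a finite group. There is a one-to-one correspondence between: 1. gauge equivalence classes of twists for $k[G]$, and 2. pairs $(K,V)$, where $K$ is a $p'$-subgroup of $G$ (a subgroup of order coprime to $p$) and $V$ is an irreducible projective representation of $K$ over $k$ of dimension $\sqrt{|K|}$, modulo inner automorphisms of $G$.
   Context: A twist for a Hopf algebra $H$ (here $H=k[G]$) with comultiplication $\Delta$ and counit $\varepsilon$ is an invertible $J\in H\otimes H$ with $(\Delta\otimes\mathrm{id})(J)(J\otimes 1)=(\mathrm{id}\otimes\Delta)(J)(1\otimes J)$, normalized by $(\varepsilon\otimes\mathrm{id})(J)=(\mathrm{id}\otimes\varepsilon)(J)=1$. Twists $J,J'$ are gauge equivalent if $J'=\Delta(x)J(x^{-1}\otimes x^{-1})$ for some invertible $x\in H$ with $\varepsilon(x)=1$. Projective representations are taken up to isomorphism; an inner automorphism $\mathrm{Ad}(g)$ of $G$ sends $(K,V)$ to $(gKg^{-1},{}^gV)$, where ${}^gV$ is $V$ with $gKg^{-1}$ acting through $x\mapsto g^{-1}xg\in K$. *)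

(* Defs.v *)
From HB Require Import structures.
From mathcomp Require Import all_boot all_order all_algebra all_fingroup all_field.
From mathcomp Require Import all_solvable.
From mathcomp Require Import boolp classical_sets functions.

Set Implicit Arguments.
Unset Strict Implicit.
Unset Printing Implicit Defensive.

Import GRing.Theory.
Local Open Scope ring_scope.

Section GroupAlgebra.
Variables (k : fieldType) (gT : finGroupType).

(* The element \sum_g a_g g of k[G] is stored as the function g |-> a_g; the
   alias keeps the convolution product apart from the pointwise one. *)
Definition grpalg : predArgType := {ffun gT -> k^o}.
HB.instance Definition _ := Vector.copy grpalg {ffun gT -> k^o}.

Implicit Types a b c : grpalg.

Definition ga_one : grpalg := [ffun g => (g == 1%g)%:R].
Definition ga_mul a b : grpalg := [ffun g => \sum_h a h * b (h^-1 * g)%g].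

Fact ga_mulA : associative ga_mul.
Proof.
move=> a b c; apply/ffunP => g; rewrite !ffunE.
transitivity (\sum_h \sum_l a h * b (h^-1 * l)%g * c (l^-1 * g)%g).
  apply: eq_bigr => h _; rewrite ffunE mulr_sumr (reindex_inj (mulgI h^-1%g)).
  apply: eq_bigr => l _; rewrite mulrA; congr (_ * c _).
  by rewrite invMg invgK -!mulgA mulKVg.
rewrite exchange_big; apply: eq_bigr => l _ /=.
by rewrite ffunE mulr_suml.
Qed.

Fact ga_mul1 : left_id ga_one ga_mul.
Proof.
move=> a; apply/ffunP => g; rewrite ffunE (bigD1 1%g) //= ffunE eqxx mul1r.
rewrite invg1 mul1g big1 ?addr0 // => h /negPf h1.
by rewrite ffunE h1 mul0r.
Qed.

Fact ga_mulr1 : right_id ga_one ga_mul.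
Proof.
move=> a; apply/ffunP => g; rewrite ffunE (bigD1 g) //= ffunE mulVg eqxx mulr1.
rewrite big1 ?addr0 // => h /negPf hg.
by rewrite ffunE -eq_mulVg1 hg mulr0.
Qed.

Fact ga_mulDl : left_distributive ga_mul +%R.
Proof.
move=> a b c; apply/ffunP => g; rewrite !ffunE -big_split.
by apply: eq_bigr => h _; rewrite ffunE mulrDl.
Qed.

Fact ga_mulDr : right_distributive ga_mul +%R.
Proof.
move=> a b c; apply/ffunP => g; rewrite !ffunE -big_split.
by apply: eq_bigr => h _; rewrite ffunE mulrDr.
Qed.

Fact ga_one_neq0 : ga_one != 0.
Proof.
by apply/eqP => /ffunP/(_ 1%g)/eqP; rewrite !ffunE eqxx oner_eq0.
Qed.

HB.instance Definition _ := GRing.Zmodule_isNzRing.Build grpalg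
  ga_mulA ga_mul1 ga_mulr1 ga_mulDl ga_mulDr ga_one_neq0.

Fact ga_scaleAl (s : k) a b : s *: (a * b) = (s *: a) * b.
Proof.
apply/ffunP => g; rewrite !ffunE [LHS]mulr_sumr.
by apply: eq_bigr => h _; rewrite ffunE [LHS]mulrA.
Qed.

HB.instance Definition _ := GRing.Lmodule_isLalgebra.Build k grpalg ga_scaleAl.

Fact ga_scaleAr (s : k) a b : s *: (a * b) = a * (s *: b).
Proof.
apply/ffunP => g; rewrite !ffunE [LHS]mulr_sumr.
by apply: eq_bigr => h _; rewrite ffunE [LHS]mulrCA.
Qed.

HB.instance Definition _ := GRing.Lalgebra_isAlgebra.Build k grpalg ga_scaleAr.
HB.instance Definition _ := Algebra_isFalgebra.Build k grpalg.

Definition counit a : k := \sum_g a g.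

End GroupAlgebra.

(* The linear map k[G] -> k[H] extending f : G -> H on the basis of group
   elements. *)
Definition ga_map (k : fieldType) (gT hT : finGroupType) (f : gT -> hT)
    (a : grpalg k gT) : grpalg k hT :=
  [ffun h => \sum_(g | f g == h) a g].

(* Tensor powers of H = k[G] are group algebras of powers of G, the pure
   tensor g (x) h being the group element (g, h). *)
Section Twists.
Variables (k : fieldType) (gT : finGroupType).

Local Notation H := (grpalg k gT).
Local Notation H2 := (grpalg k (gT * gT)%type).
Local Notation H3 := (grpalg k (gT * gT * gT)%type).

Definition tens (a b : H) : H2 := [ffun u => a u.1 * b u.2].

Definition coprod : H -> H2 := ga_map (fun g => (g, g)).
Definition coprod_id : H2 -> H3 := ga_map (fun u => (u.1, u.1, u.2)).
Definition id_coprod : H2 -> H3 := ga_map (fun u => (u.1, u.2, u.2)).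
Definition tens_one : H2 -> H3 := ga_map (fun u => (u.1, u.2, 1%g)).
Definition one_tens : H2 -> H3 := ga_map (fun u => (1%g, u.1, u.2)).
Definition counit_id : H2 -> H := ga_map (fun u => u.2).
Definition id_counit : H2 -> H := ga_map (fun u => u.1).

Definition twist (J : H2) : Prop :=
  [/\ J \is a GRing.unit,
      coprod_id J * tens_one J = id_coprod J * one_tens J,
      counit_id J = 1 & id_counit J = 1].

Definition gauge_equiv (J J' : H2) : Prop :=
  exists x : H, [/\ x \is a GRing.unit, counit x = 1
    & J' = coprod x * J * tens x^-1 x^-1].

End Twists.

Section ProjectiveRepresentations.
Variables (k : fieldType) (gT : finGroupType).

(* A homomorphism K -> PGL_n(k), given by an arbitrary lift to GL_n(k). As for
   mx_representation, matrices act on row vectors and values outside K are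
   irrelevant. *)
Definition proj_repr (K : {set gT}) n (rho : gT -> 'M[k]_n) : Prop :=
  {in K, forall x, rho x \in unitmx} /\
  {in K &, forall x y,
    exists2 c : k, c != 0 & rho x *m rho y = c *: rho (x * y)%g}.

Definition proj_irreducible (K : {set gT}) n (rho : gT -> 'M[k]_n) : Prop :=
  (0 < n)%N /\
  forall U : 'M[k]_n, {in K, forall x, (U *m rho x <= U)%MS} ->
    U != 0 -> row_full U.

(* Isomorphism intertwines the maps to PGL: the scalar c may depend on x. *)
Definition proj_iso (K : {set gT}) n m
    (rho : gT -> 'M[k]_n) (rho' : gT -> 'M[k]_m) : Prop :=
  exists P : 'M[k]_(n, m), [/\ n = m, row_free P &
    {in K, forall x,
      exists2 c : k, c != 0 & rho x *m P = c *: (P *m rho' x)}].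

Record proj_pair := ProjPair {
  pp_group : {group gT};
  pp_dim : nat;
  pp_repr : gT -> 'M[k]_pp_dim
}.

Definition admissible_pair (p : nat) (V : proj_pair) : Prop :=
  [/\ (p^'.-group (pp_group V))%g,
      proj_repr (pp_group V) (pp_repr V),
      proj_irreducible (pp_group V) (pp_repr V)
    & (pp_dim V ^ 2 = #|pp_group V|)%N].

(* mathcomp's x ^ g is g^-1 x g, so g K g^-1 is K :^ g^-1. *)
Definition pair_equiv (V W : proj_pair) : Prop :=
  exists g : gT,
    (pp_group W :=: pp_group V :^ g^-1)%g /\
    proj_iso (pp_group W) (fun x => pp_repr V (x ^ g)%g) (pp_repr W).

End ProjectiveRepresentations.

(* The set of classes of elements of A under the relation R. *)
Definition classes T (A : set T) (R : T -> T -> Prop) : set (set T) :=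
  [set (A `&` [set y | R x y])%classic | x in A]%classic.

Definition twist_classes (k : fieldType) (gT : finGroupType) :=
  classes (@twist k gT) (@gauge_equiv k gT).

Definition pair_classes (k : fieldType) (gT : finGroupType) (p : nat) :=
  classes (@admissible_pair k gT p) (@pair_equiv k gT).

Arguments twist_classes : clear implicits.
Arguments pair_classes : clear implicits.

(* Main.v *)
From HB Require Import structures.
Require Import Defs.
From mathcomp Require Import all_boot all_order all_algebra all_fingroup all_field.
From mathcomp Require Import pgroup mxrepresentation.
From mathcomp Require Import boolp classical_sets functions.

(** Let A_J be the space of functions on G with the product that is dual to the
    comultiplication x |-> \Delta(x) J of k[G]. It is an algebra on which G
    acts by left translation, and it is governed by the twist: gauge
    transformations are the isomorphisms of algebras with G-action. The theorem
    holds because this algebra is induced from a matrix algebra End(V) on which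
    the stabilizer K acts through a projective representation.

    In one direction, J being invertible produces an element T of A_J (x) A_J
    that is invariant, multiplies to 1, and multiplies to 0 when its second
    factor is translated by g != 1 ([sepid_mul], [twist_avg_intertwines]).
    Averaging with T shows that A_J is semisimple, and that every linear map
    between modules is a sum of intertwiners into translates
    ([twist_avg_translates]). For a simple module m of dimension n with
    stabilizer K, the intertwiners Q h, h in K, from m to its translates
    therefore span all matrices; they are independent, since averaging isolates
    the coefficient at 1. So |K| = n^2, and the averaging is a trace form with
    value 1 at the unit matrix, so that n is nonzero in k and K is a p'-group
    ([card_stabilizer], [dim_neq0], [realizes_exists]). Any two simple modules
    are translates of each other, so that (K, Q) is unique up to conjugation
    ([realizes_unique]).

    In the other direction let rho be an irreducible projective representation
    of a p'-group K of order n^2. Averaging over K gives orthogonality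
    relations that make the matrices rho h a basis of End(V)
    ([proj_repr_span]). It follows that the functions from K to End(V) are
    generated by the functions h |-> b (h c), hence that a multiple of End(V) is
    a multiple of the regular representation of K; by semisimplicity End(V) is
    regular itself, and it has a normal basis, the orbit of some c
    ([rank_conj_repr], [cyclic_vector_exists], [normal_basis]). The
    multiplication table of this basis, extended by 0 outside K, is a twist
    ([twist_of_pair]). The coordinate form of the same basis identifies twists
    that have the same pair ([realizes_gauge_unique]). *)

Set Implicit Arguments.
Unset Strict Implicit.
Unset Printing Implicit Defensive.

Import GRing.Theory.

(** * Group algebras and their tensor maps *)

Section GroupAlgebraFacts.
Local Open Scope ring_scope.

Variables (k : fieldType) (gT : finGroupType).
Implicit Types a b : grpalg k gT.

Lemma ga_mulE a b g : (a * b) g = \sum_h a h * b (h^-1 * g)%g.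
Proof. by rewrite ffunE. Qed.

Lemma ga_oneE g : (1 : grpalg k gT) g = (g == 1%g)%:R.
Proof. by rewrite ffunE. Qed.

End GroupAlgebraFacts.

Section GroupAlgebraMorphisms.
Local Open Scope ring_scope.

Variables (k : fieldType) (gT : finGroupType).
Implicit Types a b : grpalg k gT.

Lemma counitM a b : counit (a * b) = counit a * counit b.
Proof.
rewrite /counit mulr_suml.
under eq_bigr do rewrite ga_mulE.
rewrite exchange_big; apply: eq_bigr => h _ /=.
rewrite mulr_sumr (reindex_inj (mulgI h)) /=.
by apply: eq_bigr => g _; rewrite mulKg.
Qed.

Lemma counit1 : counit (1 : grpalg k gT) = 1.
Proof.
rewrite /counit (bigD1 1%g) //= ga_oneE eqxx big1 ?addr0 // => g /negPf g1.
by rewrite ga_oneE g1.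
Qed.

Lemma ga_mapE (hT : finGroupType) (f : gT -> hT) a y :
  ga_map f a y = \sum_(g | f g == y) a g.
Proof. by rewrite ffunE. Qed.

Lemma ga_map_mul (hT : finGroupType) (f : gT -> hT) a b :
  {morph f : x y / (x * y)%g} -> ga_map f (a * b) = ga_map f a * ga_map f b.
Proof.
move=> fM; have f1 : f 1%g = 1%g.
  by apply: (mulgI (f 1%g)); rewrite -fM !mulg1.
have fV x : f x^-1%g = (f x)^-1%g.
  by apply: (mulgI (f x)); rewrite -fM !mulgV f1.
apply/ffunP => y; rewrite ga_mulE ga_mapE.
under eq_bigr do rewrite ga_mulE.
under [RHS]eq_bigr do rewrite ga_mapE mulr_suml.
rewrite [LHS]exchange_big [RHS](exchange_big_dep predT) //=.
apply: eq_bigr => g _; rewrite (big_pred1 (f g)) => [|h]; last first.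
  by rewrite /= eq_sym.
rewrite ga_mapE mulr_sumr (reindex_inj (mulgI g)) /=.
apply: eq_big => [h|h _]; last by rewrite mulKg.
by rewrite fM -(inj_eq (mulgI (f g)^-1)%g) mulKg.
Qed.

Lemma ga_map1 (hT : finGroupType) (f : gT -> hT) :
  f 1%g = 1%g -> ga_map f (1 : grpalg k gT) = 1.
Proof.
move=> f1; apply/ffunP => y; rewrite ga_oneE ga_mapE.
under eq_bigr do rewrite ga_oneE.
have [->|y1] := eqVneq y 1%g.
  rewrite (bigD1 1%g) ?f1 //= eqxx big1 ?addr0 // => g /andP[_ /negPf->] //.
rewrite big1 // => g /eqP gy; case: eqP => // g1.
by move: y1; rewrite -gy g1 f1 eqxx.
Qed.

(** The algebra is finite dimensional, so that an injective left
    multiplication is onto, and a right inverse is then two-sided. *)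
Lemma ga_unitP a : (forall b, a * b = 0 -> b = 0) -> a \is a GRing.unit.
Proof.
move=> a_inj.
have ker0 : lker (amull a) == 0%VS.
  rewrite -subv0; apply/subvP => v; rewrite memv_ker lfunE /= => /eqP/a_inj->.
  exact: mem0v.
have [b ab] : exists b, a * b = 1.
  have := lker0_limgf ker0 => im.
  have : 1 \in limg (amull a) by rewrite im memvf.
  by case/memv_imgP => b _ ->; exists b; rewrite lfunE.
apply/unitrP; exists b; split=> //.
apply/eqP; rewrite -subr_eq0; apply/eqP/a_inj.
by rewrite mulrBr mulrA ab mul1r mulr1 subrr.
Qed.

(** All the maps into tensor powers used below are extensions of injective
    maps f of groups; with a left inverse r of f the sum defining the
    coefficients has at most one term. *)
Lemma ga_map_canE (hT : finGroupType) (f : gT -> hT) (r : hT -> gT) a y :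
  cancel f r -> ga_map f a y = if f (r y) == y then a (r y) else 0.
Proof.
move=> fK; rewrite ga_mapE; case: ifP => [/eqP fry|fry].
  by apply: big_pred1 => g /=; rewrite -{1}fry (inj_eq (can_inj fK)).
by apply: big1 => g /eqP gy; case/eqP: fry; rewrite -gy fK.
Qed.

End GroupAlgebraMorphisms.

Section TensorMaps.
Local Open Scope ring_scope.

Variables (k : fieldType) (gT : finGroupType).
Local Notation H := (grpalg k gT).
Local Notation H2 := (grpalg k (gT * gT)%type).
Implicit Types (x y : H) (I J : H2).

Lemma coprodM x y : coprod (x * y) = coprod x * coprod y.
Proof. exact: ga_map_mul. Qed.

Lemma coprod1 : coprod (1 : H) = 1.
Proof. exact: ga_map1. Qed.

Lemma tensM x x' y y' : tens (x * y) (x' * y') = tens x x' * tens y y'.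
Proof.
apply/ffunP => -[u v]; rewrite ga_mulE !ffunE /= mulr_suml.
transitivity (\sum_g \sum_h (x g * x' h) * (y (g^-1 * u)%g * y' (h^-1 * v)%g)).
  apply: eq_bigr => g _; rewrite mulr_sumr.
  by apply: eq_bigr => h _; rewrite mulrACA.
by rewrite pair_big /=; apply: eq_bigr => -[g h] _; rewrite !ffunE.
Qed.

Lemma tens1 : tens (1 : H) 1 = 1.
Proof. by apply/ffunP => -[u v]; rewrite !ffunE /= -natrM mulnb. Qed.

Lemma coprodE x u v : coprod x (u, v) = if u == v then x u else 0.
Proof.
by rewrite /coprod (@ga_map_canE _ _ _ _ fst) // xpair_eqE eqxx.
Qed.

Lemma coprod_idE J g h l :
  coprod_id J (g, h, l) = if g == h then J (g, l) else 0.
Proof.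
rewrite /coprod_id (@ga_map_canE _ _ _ _ (fun w => (w.1.1, w.2))) => [|[]//].
by rewrite /= !xpair_eqE !eqxx /= andbT.
Qed.

Lemma id_coprodE J g h l :
  id_coprod J (g, h, l) = if h == l then J (g, h) else 0.
Proof.
rewrite /id_coprod (@ga_map_canE _ _ _ _ (fun w => (w.1.1, w.1.2))) => [|[]//].
by rewrite /= !xpair_eqE !eqxx.
Qed.

Lemma tens_oneE J g h l :
  tens_one J (g, h, l) = if l == 1%g then J (g, h) else 0.
Proof.
rewrite /tens_one (@ga_map_canE _ _ _ _ (fun w => (w.1.1, w.1.2))) => [|[]//].
by rewrite /= !xpair_eqE !eqxx /= eq_sym.
Qed.

Lemma one_tensE J g h l :
  one_tens J (g, h, l) = if g == 1%g then J (h, l) else 0.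
Proof.
rewrite /one_tens (@ga_map_canE _ _ _ _ (fun w => (w.1.2, w.2))) => [|[]//].
by rewrite /= !xpair_eqE !eqxx /= !andbT eq_sym.
Qed.

Lemma counit_idE J v : counit_id J v = \sum_u J (u, v).
Proof.
rewrite ga_mapE (eq_bigl (fun w : gT * gT => predT w.1 && (w.2 == v))) //.
rewrite (eq_bigr (fun w => J (w.1, w.2))) => [|[]//].
rewrite -(pair_big predT (fun w => w == v) (fun u w => J (u, w))) /=.
by apply: eq_bigr => u _; rewrite big_pred1_eq.
Qed.

Lemma id_counitE J u : id_counit J u = \sum_v J (u, v).
Proof.
rewrite ga_mapE (eq_bigl (fun w : gT * gT => (w.1 == u) && predT w.2));
  last first.
  by move=> w; rewrite andbT.
rewrite (eq_bigr (fun w => J (w.1, w.2))) => [|[]//].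
rewrite -(pair_big (fun w => w == u) predT (fun u w => J (u, w))) /=.
by rewrite big_pred1_eq.
Qed.

Lemma coprod_idM I J : coprod_id (I * J) = coprod_id I * coprod_id J.
Proof. exact: ga_map_mul. Qed.
Lemma id_coprodM I J : id_coprod (I * J) = id_coprod I * id_coprod J.
Proof. exact: ga_map_mul. Qed.
Lemma tens_oneM I J : tens_one (I * J) = tens_one I * tens_one J.
Proof. by apply: ga_map_mul => u v; rewrite /= -{1}(mulg1 1%g). Qed.
Lemma one_tensM I J : one_tens (I * J) = one_tens I * one_tens J.
Proof. by apply: ga_map_mul => u v; rewrite /= -{1}(mulg1 1%g). Qed.

End TensorMaps.

(** * The separability idempotent of a twist *)

Lemma sum_pair (V : nmodType) (A B : finType) (F : A * B -> V) :
  (\sum_u F u = \sum_x \sum_y F (x, y))%R.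
Proof. by rewrite pair_bigA; apply: eq_bigr => -[]. Qed.

Section GroupAlgebraProducts.
Local Open Scope ring_scope.

Variables (k : fieldType) (gT hT : finGroupType) (f : gT -> hT).

Lemma ga_map_mull (a : grpalg k gT) (b : grpalg k hT) y :
  (ga_map f a * b) y = \sum_g a g * b ((f g)^-1 * y)%g.
Proof.
rewrite ga_mulE; under eq_bigr do rewrite ga_mapE mulr_suml.
rewrite (exchange_big_dep predT) //=; apply: eq_bigr => g _.
by rewrite (big_pred1 (f g)) // => h /=; rewrite eq_sym.
Qed.

Lemma ga_map_mulr (a : grpalg k gT) (b : grpalg k hT) y :
  (b * ga_map f a) y = \sum_g b (y * (f g)^-1)%g * a g.
Proof.
rewrite ga_mulE (reindex_inj (inj_comp (mulgI y) invg_inj)) /=.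
under eq_bigr do rewrite invMg invgK mulgKV ga_mapE mulr_sumr.
rewrite (exchange_big_dep predT) //=; apply: eq_bigr => g _.
by rewrite (big_pred1 (f g)) // => h /=; rewrite eq_sym.
Qed.

End GroupAlgebraProducts.

Section TwistCoordinates.
Local Open Scope ring_scope.

Variables (k : fieldType) (gT : finGroupType) (J : grpalg k (gT * gT)%type).

(** The twist equation means that the product of delta functions \delta_a \delta_b =
    \sum_x J (x^-1 a, x^-1 b) \delta_x on the functions on G is associative. *)
Lemma twist_eq_coord :
  coprod_id J * tens_one J = id_coprod J * one_tens J <->
  forall a b c : gT,
    \sum_x J (x, c) * J (x^-1 * a, x^-1 * b)%g
    = \sum_y J (a, y) * J (y^-1 * b, y^-1 * c)%g.
Proof.
have lhsE a b c : (coprod_id J * tens_one J) (a, b, c)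
    = \sum_x J (x, c) * J (x^-1 * a, x^-1 * b)%g.
  rewrite ga_map_mull sum_pair /=.
  apply: eq_bigr => x _; rewrite (bigD1 c) //= tens_oneE mulVg eqxx.
  rewrite big1 ?addr0 // => z /negPf zc.
  by rewrite tens_oneE -eq_mulVg1 zc mulr0.
have rhsE a b c : (id_coprod J * one_tens J) (a, b, c)
    = \sum_y J (a, y) * J (y^-1 * b, y^-1 * c)%g.
  rewrite ga_map_mull sum_pair /=.
  rewrite exchange_big.
  apply: eq_bigr => y _; rewrite (bigD1 a) //= one_tensE mulVg eqxx.
  rewrite big1 ?addr0 // => x /negPf xa.
  by rewrite one_tensE -eq_mulVg1 xa mulr0.
split=> [eqJ a b c|eqJ]; first by rewrite -lhsE eqJ rhsE.
by apply/ffunP => -[[a b] c]; rewrite lhsE rhsE.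
Qed.

Hypothesis twJ : twist J.

Let unitJ : J \is a GRing.unit. Proof. by case: twJ. Qed.

Lemma twist_sum_l v : \sum_u J (u, v) = (v == 1%g)%:R.
Proof. by case: twJ => _ _ /ffunP/(_ v); rewrite counit_idE ga_oneE. Qed.

Lemma twist_sum_r u : \sum_v J (u, v) = (u == 1%g)%:R.
Proof. by case: twJ => _ _ _ /ffunP/(_ u); rewrite id_counitE ga_oneE. Qed.

(** The coefficients of an element T of A_J (x) A_J, where A_J is the algebra
    of functions on G with the product defined by J. The map
    a (x) b |-> (g |-> a (g b)) from A_J (x) A_J to the functions from G to A_J
    is bijective because J is invertible, and T is the preimage of the function
    that is 1 at the unit of G and 0 elsewhere. *)
Definition sepid (a b : gT) : k := \sum_x J^-1 (a^-1 * x, b^-1 * x)%g.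

(** Together with [sepid_actr] this says c T = T c in A_J (x) A_J, both sides
    having the coefficients on the right. With J_12, J_23 for J (x) 1, 1 (x) J
    the twist equation reads J_12 J_23^-1 =
    (\Delta (x) id)(J)^-1 (id (x) \Delta)(J). Comparing coefficients and
    summing over the group, the two copies of J on the right merge and the
    counit normalization removes the last one. *)
Lemma sepid_actl c x y :
  \sum_a sepid a y * J (x^-1 * c, x^-1 * a)%g = J^-1 (x^-1 * c, y^-1 * c)%g.
Proof.
(* The coefficients at (p, q, r) of J_12 J_23^-1. *)
have split_eq p q r : \sum_v J (p, v) * J^-1 (v^-1 * q, r)%g
    = \sum_u \sum_v coprod_id J^-1 (p * u^-1, q * v^-1, r * v^-1)%g * J (u, v).
  transitivity ((tens_one J * one_tens J^-1) (p, q, r)).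
    rewrite ga_map_mull sum_pair /=.
    rewrite exchange_big; apply: eq_bigr => v _.
    rewrite (bigD1 p) //= one_tensE mulVg eqxx /= invg1 mul1g.
    rewrite big1 ?addr0 // => u /negPf up.
    by rewrite one_tensE -eq_mulVg1 up mulr0.
  have -> : tens_one J * one_tens J^-1 = coprod_id J^-1 * id_coprod J.
    case: (twJ) => _ eqJ _ _.
    have -> : tens_one J = coprod_id J^-1 * (coprod_id J * tens_one J).
      by rewrite mulrA -coprod_idM mulVr // /coprod_id ga_map1 // mul1r.
    rewrite eqJ -!mulrA -one_tensM mulrV // /one_tens ga_map1 //.
    by rewrite mulr1.
  by rewrite ga_map_mulr sum_pair.
under eq_bigr do rewrite /sepid mulr_suml.
rewrite exchange_big /=.
transitivity (\sum_z \sum_v J (x^-1 * c, v)%g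
                * J^-1 (v^-1 * (x^-1 * z), y^-1 * z)%g).
  apply: eq_bigr => z _; rewrite (reindex_inj (mulgI x)) /=.
  by apply: eq_bigr => v _; rewrite mulKg invMg -mulgA mulrC.
under eq_bigr do rewrite split_eq.
rewrite exchange_big /=.
under eq_bigr do rewrite exchange_big /=.
transitivity (\sum_u \sum_v
    J^-1 (x^-1 * c * u^-1, y^-1 * c * u^-1)%g * J (u, v)).
  apply: eq_bigr => u _; apply: eq_bigr => v _.
  rewrite (bigD1 (c * u^-1 * v)%g) //= coprod_idE !mulgA mulgK eqxx.
  rewrite mulgK big1 ?addr0 // => z zc; rewrite coprod_idE.
  case: eqP => [E|]; last by rewrite mul0r.
  case/eqP: zc; move: E; rewrite -!mulgA => /mulgI.
  by rewrite mulgA => ->; rewrite mulgKV.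
under eq_bigr do rewrite -mulr_sumr twist_sum_r.
rewrite (bigD1 1%g) //= eqxx mulr1 invg1 !mulg1 big1 ?addr0 //.
by move=> u /negPf->; rewrite mulr0.
Qed.

(** The mirror image of [sepid_actl], from J_23 J_12^-1 =
    (id (x) \Delta)(J)^-1 (\Delta (x) id)(J). *)
Lemma sepid_actr c x y :
  \sum_b sepid x b * J (y^-1 * b, y^-1 * c)%g = J^-1 (x^-1 * c, y^-1 * c)%g.
Proof.
(* The coefficients at (p, q, r) of J_23 J_12^-1. *)
have split_eq p q r : \sum_u J (u, r) * J^-1 (p, u^-1 * q)%g
    = \sum_u \sum_v id_coprod J^-1 (p * u^-1, q * u^-1, r * v^-1)%g * J (u, v).
  transitivity ((one_tens J * tens_one J^-1) (p, q, r)).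
    rewrite ga_map_mull sum_pair /=.
    apply: eq_bigr => u _.
    rewrite (bigD1 r) //= tens_oneE mulVg eqxx /= invg1 mul1g.
    rewrite big1 ?addr0 // => v /negPf vr.
    by rewrite tens_oneE -eq_mulVg1 vr mulr0.
  have -> : one_tens J * tens_one J^-1 = id_coprod J^-1 * coprod_id J.
    case: (twJ) => _ eqJ _ _.
    have -> : one_tens J = id_coprod J^-1 * (id_coprod J * one_tens J).
      by rewrite mulrA -id_coprodM mulVr // /id_coprod ga_map1 // mul1r.
    rewrite -eqJ -!mulrA -tens_oneM mulrV // /tens_one ga_map1 //.
    by rewrite mulr1.
  by rewrite ga_map_mulr sum_pair.
under eq_bigr do rewrite /sepid mulr_suml.
rewrite exchange_big /=.
transitivity (\sum_z \sum_u J (u, y^-1 * c)%g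
                * J^-1 (x^-1 * z, u^-1 * (y^-1 * z))%g).
  apply: eq_bigr => z _; rewrite (reindex_inj (mulgI y)) /=.
  by apply: eq_bigr => v _; rewrite mulKg invMg -mulgA mulrC.
under eq_bigr do rewrite split_eq.
rewrite exchange_big /=.
under eq_bigr do rewrite exchange_big /=.
transitivity (\sum_u \sum_v
    J^-1 (x^-1 * c * v^-1, y^-1 * c * v^-1)%g * J (u, v)).
  apply: eq_bigr => u _; apply: eq_bigr => v _.
  rewrite (bigD1 (c * v^-1 * u)%g) //= id_coprodE !mulgA mulgK eqxx.
  rewrite mulgK big1 ?addr0 // => z zc; rewrite id_coprodE.
  case: eqP => [E|]; last by rewrite mul0r.
  case/eqP: zc; move: E; rewrite -!mulgA => /mulgI.
  by rewrite mulgA => <-; rewrite mulgKV.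
rewrite exchange_big /=.
under eq_bigr do rewrite -mulr_sumr twist_sum_l.
rewrite (bigD1 1%g) //= eqxx mulr1 invg1 !mulg1 big1 ?addr0 //.
by move=> u /negPf->; rewrite mulr0.
Qed.

End TwistCoordinates.

(** * Modules over the twisted function algebra *)

Section TwistModules.
Local Open Scope ring_scope.

Variables (k : fieldType) (gT : finGroupType) (J : grpalg k (gT * gT)%type).

(** A unital representation of the algebra A_J of functions on G with the
    product twisted by J; m a is the image of the delta function at a. *)
Definition twist_module n (m : gT -> 'M[k]_n) : Prop :=
  (forall a b, m a *m m b = \sum_x J (x^-1 * a, x^-1 * b)%g *: m x)
  /\ \sum_g m g = 1%:M.

(** G acts on A_J by algebra automorphisms, through left translation. *)
Lemma twist_module_translate n (m : gT -> 'M[k]_n) g :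
  twist_module m -> twist_module (fun c => m (g * c)%g).
Proof.
case=> mM m1; split=> [a b|]; last first.
  by rewrite -m1 [RHS](reindex_inj (mulgI g)).
rewrite mM (reindex_inj (mulgI g)) /=; apply: eq_bigr => x _.
by rewrite invMg -!mulgA !mulKg.
Qed.

Lemma twist_module_sum n (m : gT -> 'M[k]_n) g :
  twist_module m -> \sum_c m (c * g)%g = 1%:M.
Proof. by case=> _ <-; rewrite [RHS](reindex_inj (mulIg g)). Qed.

Lemma twist_module_conj n n' (m : gT -> 'M[k]_n)
    (P : 'M_(n, n')) (Q : 'M_(n', n)) :
  P *m Q = 1%:M -> Q *m P = 1%:M -> twist_module m ->
  twist_module (fun c => Q *m m c *m P).
Proof.
move=> PQ QP [mM m1]; split=> [a b|]; last first.
  by rewrite -mulmx_suml -mulmx_sumr m1 mulmx1.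
rewrite !mulmxA -(mulmxA _ P) PQ mulmx1 -(mulmxA Q) mM mulmx_sumr mulmx_suml.
by apply: eq_bigr => x _; rewrite -scalemxAr -scalemxAl.
Qed.

Hypothesis twJ : twist J.

Let unitJ : J \is a GRing.unit. Proof. by case: twJ. Qed.

(** After the substitution a = y u, g b = y v the sum over a and b is a
    coefficient of the product J J^-1 = 1. *)
Lemma sepid_galois g y :
  \sum_a \sum_b sepid J a b * J (y^-1 * a, y^-1 * (g * b))%g = (g == 1%g)%:R.
Proof.
under eq_bigr do under eq_bigr do rewrite /sepid mulr_suml.
under eq_bigr do rewrite exchange_big /=.
rewrite exchange_big /=.
transitivity (\sum_x (J * J^-1) (y^-1 * x, y^-1 * (g * x))%g).
  apply: eq_bigr => x _; rewrite ga_mulE sum_pair (reindex_inj (mulgI y)) /=.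
  apply: eq_bigr => u _; rewrite (reindex_inj (mulgI (g^-1 * y)%g)) /=.
  apply: eq_bigr => v _.
  rewrite mulrC mulKg !invMg invgK; congr (J (_, _) * J^-1 (_, _)).
  - by rewrite -(mulgA g^-1)%g mulKVg mulKg.
  - by rewrite /= !mulgA.
  - by rewrite /= !mulgA.
rewrite mulrV // (bigD1 y) //= ga_oneE xpair_eqE mulVg eqxx /=.
rewrite -(inj_eq (mulgI y)) mulKVg mulg1 -{2}(mul1g y) (inj_eq (mulIg y)).
rewrite big1 ?addr0 // => x /negPf xy.
by rewrite ga_oneE xpair_eqE -eq_mulVg1 eq_sym xy.
Qed.

(** The case g = 1 makes T a separability idempotent, so that A_J is
    semisimple. The vanishing for g != 1 is the Galois property of A_J, from
    which the order of the stabilizer of a simple module is computed. *)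
Lemma sepid_mul n (m : gT -> 'M[k]_n) g : twist_module m ->
  \sum_a \sum_b sepid J a b *: (m a *m m (g * b)%g) = (g == 1%g)%:R *: 1%:M.
Proof.
case=> mM m1.
under eq_bigr do under eq_bigr do rewrite mM scaler_sumr.
under eq_bigr do rewrite exchange_big /=.
rewrite exchange_big /= -m1 scaler_sumr; apply: eq_bigr => y _.
rewrite -(sepid_galois g y) scaler_suml; apply: eq_bigr => a _.
by rewrite scaler_suml; apply: eq_bigr => b _; rewrite scalerA.
Qed.

(** The average of a linear map with respect to T, an intertwiner by
    [twist_avg_intertwines]. *)
Definition twist_avg n n' (m : gT -> 'M[k]_n) (m' : gT -> 'M[k]_n')
    (X : 'M[k]_(n, n')) : 'M[k]_(n, n') :=
  \sum_a \sum_b sepid J a b *: (m a *m X *m m' b).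

Lemma twist_avg_intertwines n n' (m : gT -> 'M[k]_n) (m' : gT -> 'M[k]_n') X c :
  twist_module m -> twist_module m' ->
  m c *m twist_avg m m' X = twist_avg m m' X *m m' c.
Proof.
move=> [mM _] [mM' _].
transitivity (\sum_x \sum_y J^-1 (x^-1 * c, y^-1 * c)%g *: (m x *m X *m m' y)).
  rewrite mulmx_sumr; under eq_bigr do rewrite mulmx_sumr.
  rewrite exchange_big [RHS]exchange_big /=; apply: eq_bigr => b _.
  under eq_bigr do rewrite -scalemxAr !mulmxA mM !mulmx_suml scaler_sumr.
  rewrite exchange_big /=; apply: eq_bigr => x _.
  rewrite -(sepid_actl twJ) scaler_suml; apply: eq_bigr => a _.
  by rewrite -!scalemxAl scalerA.
rewrite mulmx_suml; apply: eq_bigr => x _; rewrite mulmx_suml.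
under [RHS]eq_bigr do rewrite -scalemxAl -!mulmxA mM' !mulmx_sumr scaler_sumr.
rewrite exchange_big /=; apply: eq_bigr => y _.
rewrite -(sepid_actr twJ) scaler_suml; apply: eq_bigr => b _.
by rewrite -!scalemxAr scalerA !mulmxA.
Qed.

(** The translates of m' b add up to 1, and then so do the terms of T in its
    first factor. Each summand is an intertwiner, and when X is nonzero some
    translate of m' receives a nonzero intertwiner from m: up to the
    action of G the algebra A_J has only one simple module. *)
Lemma twist_avg_translates n n' (m : gT -> 'M[k]_n) (m' : gT -> 'M[k]_n') X :
  twist_module m -> twist_module m' ->
  \sum_g twist_avg m (fun c => m' (g * c)%g) X = X.
Proof.
move=> modm modm'.
have sum1 : \sum_a \sum_b sepid J a b *: m a = 1%:M.
  transitivity (\sum_g \sum_a \sum_b sepid J a b *: (m a *m m (g * b)%g)).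
    rewrite [RHS]exchange_big /=; apply: eq_bigr => a _.
    rewrite [RHS]exchange_big /=; apply: eq_bigr => b _.
    by rewrite -scaler_sumr -mulmx_sumr twist_module_sum // mulmx1.
  under eq_bigr do rewrite sepid_mul //.
  rewrite (bigD1 1%g) //= eqxx scale1r big1 ?addr0 // => g /negPf->.
  by rewrite scale0r.
rewrite -[RHS]mul1mx -sum1 exchange_big mulmx_suml; apply: eq_bigr => a _ /=.
rewrite exchange_big mulmx_suml; apply: eq_bigr => b _ /=.
by rewrite -scaler_sumr -mulmx_sumr twist_module_sum // mulmx1 scalemxAl.
Qed.

End TwistModules.

(** * Schur's lemma and spanning families *)

Section Schur.
Local Open Scope ring_scope.

(** The kernel and the image of an intertwiner are stable subspaces. *)
Lemma schur_unit (k : fieldType) (gT : finGroupType) (K : {set gT}) n n'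
    (m : gT -> 'M[k]_n) (m' : gT -> 'M[k]_n') (P : 'M_(n, n')) :
  proj_irreducible K m -> proj_irreducible K m' ->
  {in K, forall c, m c *m P = P *m m' c} -> P != 0 -> row_free P /\ row_full P.
Proof.
move=> [_ irr] [_ irr'] mP P0; split.
  rewrite -kermx_eq0; apply: contraNT P0 => ker0.
  have kerP : {in K, forall c, (kermx P *m m c <= kermx P)%MS}.
    move=> c Kc; apply/sub_kermxP.
    by rewrite -mulmxA mP // mulmxA mulmx_ker mul0mx.
  have /row_fullP[B BK] := irr _ kerP ker0.
  by rewrite -[P]mul1mx -BK -mulmxA mulmx_ker mulmx0.
suff: row_full <<P>>%MS by rewrite /row_full genmxE.
apply: irr' => [c Kc|]; last by rewrite -mxrank_eq0 genmxE mxrank_eq0.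
rewrite (eqmxMr _ (genmxE P)) genmxE -mP //; exact: submxMl.
Qed.

Lemma schur_scalar (k : closedFieldType) (gT : finGroupType) (K : {set gT}) n
    (m : gT -> 'M[k]_n) (P : 'M_n) :
  proj_irreducible K m -> {in K, forall c, m c *m P = P *m m c} ->
  exists a, P = a%:M.
Proof.
move=> irr mP; have n_gt0 := irr.1.
have /closed_rootP[a] : size (char_poly P) != 1.
  by rewrite size_char_poly eqSS -lt0n.
rewrite -eigenvalue_root_char => ev; exists a; apply/eqP.
rewrite -subr_eq0; apply: contraTT ev => Pa0.
have [|+ _] := schur_unit irr irr _ Pa0.
  by move=> c Kc; rewrite mulmxBl mulmxBr mP // scalar_mxC.
by rewrite -kermx_eq0 /eigenvalue /eigenspace => ->.
Qed.

(** A nonzero row vector can be moved to any other one by a matrix. *)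
Lemma span_irreducible (k : fieldType) (gT : finGroupType) (K : {set gT}) n
    (m : gT -> 'M[k]_n) : (0 < n)%N ->
  (forall X : 'M_n, exists a : gT -> k, X = \sum_(h in K) a h *: m h) ->
  proj_irreducible K m.
Proof.
move=> n_gt0 span; split=> // U stabU /matrix0Pn[i [j Uij]].
have stab X : (U *m X <= U)%MS.
  have [a ->] := span X; rewrite mulmx_sumr summx_sub // => h Kh.
  by rewrite -scalemxAr scalemx_sub ?stabU.
have free_u : row_free (row i U).
  rewrite -row_leq_rank lt0n mxrank_eq0; apply: contraNneq Uij => u0.
  by move/rowP/(_ j): u0; rewrite !mxE => ->.
rewrite -sub1mx; apply/row_subP => l.
apply: submx_trans (stab (pinvmx (row i U) *m row l 1%:M)).
by apply: (eq_row_sub i); rewrite row_mul mulmxA mulmxVp ?mul1mx.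
Qed.

End Schur.

Section MatrixFamilies.
Local Open Scope ring_scope.

Variables (k : fieldType) (gT : finGroupType) (K : {group gT}) (n : nat).

(** Linear independence and generation of the family Q become the two rank
    conditions on this matrix. *)
Definition family_mx (Q : gT -> 'M[k]_n) : 'M[k]_(#|K|, n * n) :=
  \matrix_i mxvec (Q (enum_val i)).

Lemma mul_family_mx (Q : gT -> 'M[k]_n) (v : 'rV_#|K|) :
  v *m family_mx Q = mxvec (\sum_(h in K) v 0 (gring_index K h) *: Q h).
Proof.
rewrite mulmx_sum_row linear_sum /= [RHS]big_enum_val /=.
apply: eq_bigr => i _; rewrite linearZ /= rowK; congr (v 0 _ *: _).
by rewrite gring_valK.
Qed.

Lemma family_mx_free (Q : gT -> 'M[k]_n) :
  (forall a : gT -> k, \sum_(h in K) a h *: Q h = 0 ->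
     {in K, forall h, a h = 0}) ->
  row_free (family_mx Q).
Proof.
move=> freeQ; apply: inj_row_free => v.
rewrite mul_family_mx => /eqP; rewrite mxvec_eq0 => /eqP/freeQ a0.
by apply/rowP => i; rewrite -(gring_valK i) a0 ?enum_valP // mxE.
Qed.

Lemma family_mx_full (Q : gT -> 'M[k]_n) :
  (forall X, exists a : gT -> k, X = \sum_(h in K) a h *: Q h) ->
  row_full (family_mx Q).
Proof.
move=> spanQ; rewrite -sub1mx; apply/row_subP => i.
have [a] := spanQ (vec_mx (row i 1%:M)).
move/(congr1 mxvec); rewrite vec_mxK => ->.
rewrite linear_sum /= summx_sub // => h Kh; rewrite linearZ scalemx_sub //.
by apply: (eq_row_sub (gring_index K h)); rewrite rowK gring_indexK.
Qed.

Lemma family_mx_span (Q : gT -> 'M[k]_n) X : row_full (family_mx Q) ->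
  exists a : gT -> k, X = \sum_(h in K) a h *: Q h.
Proof.
move=> fullQ.
have /submxP[v] : (mxvec X <= family_mx Q)%MS by apply: submx_full.
rewrite mul_family_mx => /(can_inj mxvecK) ->.
by exists (fun h => v 0 (gring_index K h)).
Qed.

End MatrixFamilies.

(** * The stabilizer of an irreducible module *)

Lemma irreducible_translate (k : fieldType) (gT : finGroupType) n
    (m : gT -> 'M[k]_n) g :
  proj_irreducible [set: gT] m ->
  proj_irreducible [set: gT] (fun c => m (g * c)%g).
Proof.
move=> [n_gt0 irrm]; split=> // U stabU; apply: irrm => c _.
by have := stabU (g^-1 * c)%g (finset.in_setT _); rewrite mulKVg.
Qed.

Section Stabilizer.
Local Open Scope ring_scope.

Variables (k : closedFieldType) (gT : finGroupType).
Variables (J : grpalg k (gT * gT)%type) (n : nat) (m : gT -> 'M[k]_n).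
Hypotheses (twJ : twist J) (modm : twist_module J m).
Hypothesis irrm : proj_irreducible [set: gT] m.

(** Y is an isomorphism from m to its translate by g when Y is invertible. *)
Definition intertwines g (Y : 'M[k]_n) := forall c, m (g * c)%g *m Y = Y *m m c.

Lemma intertwinesM g h Y Z :
  intertwines g Y -> intertwines h Z -> intertwines (g * h)%g (Y *m Z).
Proof. by move=> gY hZ c; rewrite mulmxA -mulgA gY -mulmxA hZ mulmxA. Qed.

Lemma intertwinesV g Y :
  Y \in unitmx -> intertwines g Y -> intertwines g^-1%g (invmx Y).
Proof.
move=> uY gY c; apply: (can_inj (mulKmx uY)).
by rewrite mulmxA -gY mulKVg mulmxK // mulKVmx.
Qed.

Lemma intertwines1_scalar Y : intertwines 1%g Y -> exists a, Y = a%:M.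
Proof.
by move=> iY; apply: schur_scalar irrm _ => c _; rewrite -iY mul1g.
Qed.

Lemma intertwines_scalar g Y Z :
  Y \in unitmx -> intertwines g Y -> intertwines g Z -> exists a, Z = a *: Y.
Proof.
move=> uY gY gZ; have /intertwines1_scalar[a] : intertwines 1%g (invmx Y *m Z).
  by rewrite -(mulVg g); apply: intertwinesM gZ; apply: intertwinesV.
by move/(congr1 (mulmx Y)); rewrite mulKVmx // mul_mx_scalar => ->; exists a.
Qed.

(** An intertwiner commutes past m at the price of a translation, so that its
    average is a case of [sepid_mul]. *)
Lemma twist_avg_intertwiner g Y :
  intertwines g Y -> twist_avg J m m Y = (g == 1%g)%:R *: Y.
Proof.
move=> gY; rewrite -[Y in RHS]mul1mx scalemxAl -(sepid_mul twJ g modm).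
rewrite mulmx_suml; apply: eq_bigr => a _; rewrite mulmx_suml.
by apply: eq_bigr => b _; rewrite -scalemxAl -!mulmxA gY.
Qed.

Lemma twist_avgZ a X : twist_avg J m m (a *: X) = a *: twist_avg J m m X.
Proof.
rewrite scaler_sumr; apply: eq_bigr => c _; rewrite scaler_sumr.
apply: eq_bigr => d _.
by rewrite -scalemxAr -scalemxAl !scalerA mulrC.
Qed.

Lemma twist_avg_bigsum I (r : seq I) P (F : I -> 'M[k]_n) :
  twist_avg J m m (\sum_(i <- r | P i) F i)
  = \sum_(i <- r | P i) twist_avg J m m (F i).
Proof.
rewrite [RHS]exchange_big; apply: eq_bigr => c _ /=.
rewrite [RHS]exchange_big; apply: eq_bigr => d _ /=.
by rewrite mulmx_sumr mulmx_suml scaler_sumr.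
Qed.

(** Multiply a linear relation by the inverse of one of its members: the
    average then kills all the terms but that one. *)
Lemma intertwiners_free (K : {set gT}) (Q : gT -> 'M[k]_n) :
  {in K, forall h, Q h \in unitmx} -> {in K, forall h, intertwines h (Q h)} ->
  forall a : gT -> k, \sum_(h in K) a h *: Q h = 0 -> {in K, forall h, a h = 0}.
Proof.
move=> uQ iQ a sum0 g Kg.
have /(congr1 (twist_avg J m m)) :
    \sum_(h in K) a h *: (invmx (Q g) *m Q h) = 0.
  under eq_bigr do rewrite scalemxAr.
  by rewrite -mulmx_sumr sum0 mulmx0.
rewrite twist_avg_bigsum -[0 in RHS](scale0r (1%:M : 'M[k]_n)) twist_avgZ.
rewrite scale0r (bigD1 g) //= twist_avgZ.
rewrite (@twist_avg_intertwiner (g^-1 * g)%g); last first.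
  by apply: intertwinesM (iQ _ Kg); apply: intertwinesV (iQ _ Kg); apply: uQ.
rewrite mulVg eqxx scale1r mulVmx ?uQ // big1 ?addr0 => [|h /andP[Kh hg]].
  rewrite scalemx1 => /matrixP/(_ (Ordinal irrm.1) (Ordinal irrm.1)).
  by rewrite !mxE eqxx mulr1n.
rewrite twist_avgZ (@twist_avg_intertwiner (g^-1 * h)%g); last first.
  by apply: intertwinesM (iQ _ Kh); apply: intertwinesV (iQ _ Kg); apply: uQ.
by rewrite -eq_mulVg1 eq_sym (negPf hg) scale0r scaler0.
Qed.

Definition stabilizer : {set gT} :=
  [set g | `[< exists2 Q, Q \in unitmx & intertwines g Q >]].

Lemma stabilizerP g :
  reflect (exists2 Q, Q \in unitmx & intertwines g Q) (g \in stabilizer).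
Proof. by rewrite inE; apply: asboolP. Qed.

Lemma stabilizer_group_set : group_set stabilizer.
Proof.
apply/group_setP; split=> [|g h /stabilizerP[Y uY gY] /stabilizerP[Z uZ hZ]].
  apply/stabilizerP; exists 1%:M; rewrite ?unitmx1 // => c.
  by rewrite mul1g mulmx1 mul1mx.
apply/stabilizerP; exists (Y *m Z); first by rewrite unitmx_mul uY.
exact: intertwinesM.
Qed.
Canonical stabilizer_group := Group stabilizer_group_set.

Lemma intertwiner_unit g Y : intertwines g Y -> Y != 0 -> Y \in unitmx.
Proof.
move=> gY Y0; rewrite -row_free_unit.
by case: (schur_unit (irreducible_translate g irrm) irrm (fun c _ => gY c) Y0).
Qed.

(** The summands in [twist_avg_translates] intertwine m with translates of
    itself: those outside the stabilizer vanish and the others are multiples of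
    the Q h by Schur's lemma. *)
Lemma stabilizer_span (Q : gT -> 'M[k]_n) :
  {in stabilizer, forall h, Q h \in unitmx} ->
  {in stabilizer, forall h, intertwines h (Q h)} ->
  forall X, exists a : gT -> k, X = \sum_(h in stabilizer) a h *: Q h.
Proof.
move=> uQ iQ X.
pose P g := twist_avg J m (fun c => m (g * c)%g) X.
have iP g : intertwines g^-1%g (P g).
  move=> c; rewrite (@twist_avg_intertwines _ _ _ twJ) //; last first.
    exact: twist_module_translate.
  by rewrite mulKVg.
have PQ g : exists a, (g^-1%g \in stabilizer -> P g = a *: Q g^-1%g)
                   /\ (g^-1%g \notin stabilizer -> P g = 0).
  have [Sg|nSg] := boolP (g^-1%g \in stabilizer).
    by have [a Pa] := intertwines_scalar (uQ _ Sg) (iQ _ Sg) (iP g); exists a.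
  exists 0; split=> // _; apply: contraNeq nSg => P0.
  by apply/stabilizerP; exists (P g) => //; apply: intertwiner_unit (iP g) P0.
have [a Pa] := choice PQ.
exists (fun h => a h^-1%g).
rewrite -[LHS](twist_avg_translates twJ X modm modm) (reindex_inj invg_inj) /=.
rewrite (bigID [in stabilizer]) /= [X in _ + X]big1 ?addr0 => [|h nSh].
  by apply: eq_bigr => h Sh; rewrite -/(P _) (Pa h^-1%g).1 invgK.
by rewrite -/(P _) (Pa h^-1%g).2 ?invgK.
Qed.

Lemma stabilizer_choice : exists Q : gT -> 'M[k]_n,
  {in stabilizer, forall h, Q h \in unitmx} /\
  {in stabilizer, forall h, intertwines h (Q h)}.
Proof.
have /choice[Q QP] g :
    exists Y, g \in stabilizer -> Y \in unitmx /\ intertwines g Y.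
  have [/stabilizerP[Y uY gY]|nS] := boolP (g \in stabilizer).
    by exists Y.
  by exists 0.
by exists Q; split=> h /QP[].
Qed.

Lemma card_stabilizer : #|stabilizer| = (n * n)%N.
Proof.
have [Q [uQ iQ]] := stabilizer_choice.
have free := family_mx_free (K := stabilizer_group) (intertwiners_free uQ iQ).
have full := family_mx_full (K := stabilizer_group) (stabilizer_span uQ iQ).
by move: free full; rewrite /row_free /row_full => /eqP-> /eqP.
Qed.

(** On the basis of the Q h: the averages of Q g Q h and of Q h Q g vanish
    unless g h = 1, and then the two products are the same scalar. *)
Lemma twist_avg_comm X Y : twist_avg J m m (X *m Y) = twist_avg J m m (Y *m X).
Proof.
have [Q [uQ iQ]] := stabilizer_choice.
have [a ->] := stabilizer_span uQ iQ X; have [b ->] := stabilizer_span uQ iQ Y.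
rewrite mulmx_suml mulmx_sumr !twist_avg_bigsum; apply: eq_bigr => g Sg.
rewrite mulmx_suml mulmx_sumr !twist_avg_bigsum; apply: eq_bigr => h Sh.
rewrite -!scalemxAl -!scalemxAr !twist_avgZ !scalerA mulrC; congr (_ *: _).
have igh := intertwinesM (iQ _ Sg) (iQ _ Sh).
have ihg := intertwinesM (iQ _ Sh) (iQ _ Sg).
rewrite (twist_avg_intertwiner igh) (twist_avg_intertwiner ihg).
have [hg|gh] := eqVneq (h * g)%g 1%g; last first.
  suff /negPf-> : (g * h)%g != 1%g by rewrite !scale0r.
  apply: contraNneq gh => /(canRL (mulKg g)).
  by rewrite mulg1 => ->; rewrite mulVg.
have gh : (g * h)%g = 1%g by rewrite -(mulgK g h) hg mul1g mulgV.
rewrite gh eqxx; move: igh; rewrite gh => /intertwines1_scalar[c gc].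
congr (_ *: _); rewrite gc; apply: (can_inj (mulKmx (uQ _ Sg))).
by rewrite mulmxA gc scalar_mxC.
Qed.

(** By Schur's lemma and [twist_avg_comm] the average is a trace form, so that
    it takes the same value on all the diagonal matrix units. Their sum has
    average 1, hence the number n of these units is nonzero in k. *)
Lemma dim_neq0 : n%:R != 0 :> k.
Proof.
pose i0 := Ordinal irrm.1.
have avg1 : twist_avg J m m 1%:M = 1%:M.
  rewrite (@twist_avg_intertwiner 1%g) ?eqxx ?scale1r // => c.
  by rewrite mul1g mulmx1 mul1mx.
have : n%:R *: twist_avg J m m (delta_mx i0 i0) = 1%:M.
  rewrite -avg1 [in RHS]mx1_sum_delta.
  rewrite twist_avg_bigsum (eq_bigr (fun=> twist_avg J m m (delta_mx i0 i0))).
    by rewrite sumr_const card_ord scaler_nat.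
  move=> i _; rewrite -(mul_delta_mx i0 i i) twist_avg_comm.
  by rewrite mul_delta_mx.
move=> eq1; apply/eqP => n0; move: eq1; rewrite n0 scale0r.
by move/matrixP/(_ i0 i0); rewrite !mxE eqxx => /eqP; rewrite eq_sym oner_eq0.
Qed.

End Stabilizer.

(** * Existence and faithfulness of modules *)

Lemma sum_enum (V : nmodType) (T : finType) (F : T -> V) :
  (\sum_(i < #|T|) F (enum_val i) = \sum_x F x)%R.
Proof. by rewrite -(big_enum_val (A := T) F); apply: eq_bigl. Qed.

Section RegularModule.
Local Open Scope ring_scope.

Variables (k : fieldType) (gT : finGroupType) (J : grpalg k (gT * gT)%type).
Hypothesis twJ : twist J.

(** Right multiplication by the delta function at a on A_J, in the basis of
    delta functions. *)
Definition regular_module (a : gT) : 'M[k]_#|gT| :=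
  \matrix_(i, j) J ((enum_val j)^-1 * enum_val i, (enum_val j)^-1 * a)%g.

Lemma regular_moduleP : twist_module J regular_module.
Proof.
have [_ /twist_eq_coord eqJ _ _] := twJ.
split=> [a b|]; apply/matrixP => i j; rewrite !(mxE, summxE).
  pose z := enum_val j; transitivity (\sum_x J (x, z^-1 * b)%g
      * J (x^-1 * (z^-1 * enum_val i), x^-1 * (z^-1 * a))%g).
    rewrite (reindex_inj (mulgI z^-1)%g) /= -[RHS]sum_enum.
    apply: eq_bigr => l _; rewrite !mxE -/z mulrC invMg invgK -!mulgA !mulKVg.
    by [].
  rewrite eqJ (reindex_inj (mulgI z^-1)%g) /=; apply: eq_bigr => x _.
  by rewrite !mxE -/z mulrC invMg invgK -!mulgA !mulKVg.
under eq_bigr do rewrite mxE.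
transitivity (\sum_x J ((enum_val j)^-1 * enum_val i, x)%g).
  by rewrite [RHS](reindex_inj (mulgI (enum_val j)^-1%g)).
by rewrite twist_sum_r // -eq_mulVg1 (inj_eq enum_val_inj) eq_sym.
Qed.

End RegularModule.

Section Faithful.
Local Open Scope ring_scope.

Variables (k : fieldType) (gT : finGroupType) (J : grpalg k (gT * gT)%type).
Hypothesis twJ : twist J.

(** The translates of m are jointly faithful. By [twist_avg_translates] every
    linear map between the regular module and m is a sum of intertwiners into
    translates of m; so an element that acts by 0 on all these translates acts
    by 0 on the regular module, where it is recovered from its action on 1. *)
Lemma twist_module_faithful n (m : gT -> 'M[k]_n) (f : gT -> k) :
  (0 < n)%N -> twist_module J m ->
  (forall g, \sum_c f c *: m (g * c)%g = 0) -> forall c, f c = 0.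
Proof.
move=> n_gt0 modm f0 c.
pose R := \sum_c f c *: regular_module J c.
have modR := regular_moduleP twJ.
have R0 (X : 'M_(_, n)) : R *m X = 0.
  rewrite -(twist_avg_translates twJ X modR modm) mulmx_sumr big1 // => g _.
  rewrite mulmx_suml; set A := twist_avg _ _ _ X.
  rewrite -[RHS](mulmx0 _ A) -(f0 g) mulmx_sumr /A; apply: eq_bigr => d _.
  rewrite -scalemxAl -scalemxAr (@twist_avg_intertwines _ _ _ twJ) //.
  exact: twist_module_translate.
have Rcol j : \sum_i R i j = 0.
  apply: big1 => i _.
  have /matrixP/(_ i (Ordinal n_gt0)) := R0 (delta_mx j (Ordinal n_gt0)).
  rewrite !mxE (bigD1 j) //= !mxE !eqxx mulr1 big1 ?addr0 // => l /negPf lj.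
  by rewrite mxE lj mulr0.
have := Rcol (enum_rank c).
under eq_bigr do rewrite summxE.
rewrite exchange_big /= (bigD1 c) //=.
have colE d : \sum_i (f d *: regular_module J d) i (enum_rank c)
    = f d * (d == c)%:R.
  under eq_bigr do rewrite !mxE enum_rankK.
  rewrite -mulr_sumr; congr (_ * _).
  transitivity (\sum_x J (x, c^-1 * d)%g).
    by rewrite [RHS](reindex_inj (mulgI c^-1%g)) /= -[RHS]sum_enum.
  by rewrite twist_sum_l // -eq_mulVg1 eq_sym.
rewrite colE eqxx mulr1 big1 ?addr0 // => d /negPf dc.
by rewrite colE dc mulr0.
Qed.

(** A nonzero module of minimal dimension. *)
Lemma irreducible_module_exists : exists n (m : gT -> 'M[k]_n),
  twist_module J m /\ proj_irreducible [set: gT] m.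
Proof.
pose P n := `[< (0 < n)%N /\ exists m : gT -> 'M[k]_n, twist_module J m >].
have exP : exists n, P n.
  exists #|gT|; apply/asboolP; split; first by apply/card_gt0P; exists 1%g.
  by exists (regular_module J); apply: regular_moduleP.
case: (ex_minnP exP) => n /asboolP[n_gt0 [m modm]] min_n.
exists n, m; split=> //; split=> // U stabU U0.
pose B := row_base U; pose B' := pinvmx B.
have BB' : B *m B' = 1%:M by apply: mulmxVp; apply: row_base_free.
have stabB c : B *m m c *m B' *m B = B *m m c.
  apply: mulmxKpV; rewrite (eqmxMr _ (eq_row_base U)) eq_row_base.
  by apply: stabU; apply: finset.in_setT.
move: B B' BB' stabB => B B' BB' stabB.
rewrite /row_full eqn_leq rank_leq_col min_n //.
apply/asboolP; split; first by rewrite lt0n mxrank_eq0.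
case: modm => mM m1; exists (fun c => B *m m c *m B'); split=> [a b|].
  rewrite /= !mulmxA stabB -(mulmxA B) mM mulmx_sumr mulmx_suml.
  by apply: eq_bigr => x _; rewrite -scalemxAr -scalemxAl.
by rewrite -mulmx_suml -mulmx_sumr m1 mulmx1.
Qed.

End Faithful.

(** * Convolution and gauge transformations *)

Section Convolution.
Local Open Scope ring_scope.

Variables (k : fieldType) (V : lmodType k).

(** The product, in the right k[G]-module of elements of V (x) k[G], of the
    element with coefficients F and of a. *)
Definition conv (gT : finGroupType) (F : gT -> V) (a : grpalg k gT) : gT -> V :=
  fun g => \sum_h a (h^-1 * g)%g *: F h.

Lemma convM (gT : finGroupType) (F : gT -> V) a b :
  conv F (a * b) = conv (conv F a) b.
Proof.
apply/funext => g; rewrite /conv.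
under eq_bigr do rewrite ga_mulE scaler_suml.
under [RHS]eq_bigr do rewrite scaler_sumr.
rewrite [RHS]exchange_big /=; apply: eq_bigr => h _.
rewrite [RHS](reindex_inj (mulgI h)) /=; apply: eq_bigr => l _.
by rewrite mulKg invMg -mulgA scalerA mulrC.
Qed.

Lemma conv1 (gT : finGroupType) (F : gT -> V) : conv F 1 = F.
Proof.
apply/funext => g; rewrite /conv (bigD1 g) //= ga_oneE mulVg eqxx scale1r.
rewrite big1 ?addr0 // => h /negPf hg.
by rewrite ga_oneE -eq_mulVg1 hg scale0r.
Qed.

Lemma convB (gT : finGroupType) (F : gT -> V) a b g :
  conv F (a - b) g = conv F a g - conv F b g.
Proof.
rewrite /conv -sumrB; apply: eq_bigr => h _.
by rewrite ffunE -scalerBl ffunE.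
Qed.

Lemma sum_conv (gT : finGroupType) (F : gT -> V) a :
  \sum_g conv F a g = counit a *: \sum_h F h.
Proof.
rewrite /conv exchange_big /= scaler_sumr; apply: eq_bigr => h _.
rewrite -scaler_suml; congr (_ *: _).
by rewrite (reindex_inj (mulgI h)); apply: eq_bigr => g _; rewrite mulKg.
Qed.

(** The image of F under id (x) \Delta, as an element of V (x) k[G x G]. *)
Definition diag_fun (gT : finGroupType) (F : gT -> V) : gT * gT -> V :=
  fun u => if u.1 == u.2 then F u.1 else 0.

Lemma conv_diagE (gT : finGroupType) (F : gT -> V)
    (Z : grpalg k (gT * gT)%type) g h :
  conv (diag_fun F) Z (g, h) = \sum_x Z (x^-1 * g, x^-1 * h)%g *: F x.
Proof.
rewrite /conv sum_pair; apply: eq_bigr => x _.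
rewrite (bigD1 x) //= /diag_fun /= eqxx big1 ?addr0 // => y /negPf xy.
by rewrite eq_sym xy scaler0.
Qed.

Lemma conv_diag_coprod (gT : finGroupType) (F : gT -> V) (a : grpalg k gT) :
  conv (diag_fun F) (coprod a) = diag_fun (conv F a).
Proof.
apply/funext => -[g h]; rewrite conv_diagE /diag_fun /=.
case: eqP => [->|gh]; first by apply: eq_bigr => x _; rewrite coprodE eqxx.
apply: big1 => x _; rewrite coprodE (inj_eq (mulgI _)).
by move/eqP/negPf: gh => ->; rewrite scale0r.
Qed.

End Convolution.

Section ConvolutionMatrices.
Local Open Scope ring_scope.

Variables (k : fieldType) (gT : finGroupType) (n : nat).
Implicit Types (m : gT -> 'M[k]_n).

Definition box_fun m : gT * gT -> 'M[k]_n := fun u => m u.1 *m m u.2.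

Lemma conv_box_tens m (a b : grpalg k gT) g h :
  conv (box_fun m) (tens a b) (g, h) = conv m a g *m conv m b h.
Proof.
rewrite /conv sum_pair mulmx_suml; apply: eq_bigr => x _.
rewrite mulmx_sumr; apply: eq_bigr => y _.
by rewrite ffunE -scalemxAl -scalemxAr scalerA.
Qed.

(** The module equation in the compact form m_1 m_2 = \Delta(m) J. *)
Lemma twist_moduleE (J : grpalg k (gT * gT)%type) m :
  twist_module J m <->
  box_fun m = conv (diag_fun m) J /\ \sum_g m g = 1%:M.
Proof.
split=> -[mM m1]; split=> //.
  by apply/funext => -[a b]; rewrite conv_diagE /box_fun mM.
by move=> a b; rewrite -conv_diagE -mM.
Qed.

(** On each coset of the diagonal, Z is a function that acts by 0 on all the
    translates of m, so that [twist_module_faithful] applies to it. *)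
Lemma conv_diag_inj (J : grpalg k (gT * gT)%type) m
    (Z : grpalg k (gT * gT)%type) :
  (0 < n)%N -> twist J -> twist_module J m ->
  (forall u, conv (diag_fun m) Z u = 0) -> Z = 0.
Proof.
move=> n_gt0 twJ modm Z0; apply/ffunP => -[s t].
have := twist_module_faithful twJ (f := fun c => Z (c^-1 * s, c^-1 * t)%g)
  n_gt0 modm.
move=> /(_ _ 1%g); rewrite invg1 !mul1g => ->; first by rewrite ffunE.
move=> g; rewrite -[RHS](Z0 (g * s, g * t)%g) conv_diagE.
rewrite [RHS](reindex_inj (mulgI g)) /=.
by apply: eq_bigr => x _; rewrite invMg -!mulgA !mulKg.
Qed.

Lemma conv_inj (J : grpalg k (gT * gT)%type) m (y : grpalg k gT) :
  (0 < n)%N -> twist J -> twist_module J m ->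
  (forall g, conv m y g = 0) -> y = 0.
Proof.
move=> n_gt0 twJ modm y0; apply/ffunP => s.
have := twist_module_faithful twJ (f := fun c => y (c^-1 * s)%g) n_gt0 modm.
move=> /(_ _ 1%g); rewrite invg1 !mul1g => ->; first by rewrite ffunE.
move=> g; rewrite -[RHS](y0 (g * s)%g) /conv [RHS](reindex_inj (mulgI g)) /=.
by apply: eq_bigr => x _; rewrite invMg -!mulgA !mulKg.
Qed.

(** If m_1 m_2 = \Delta(m) J' then (m x)_1 (m x)_2 = \Delta(m) J' (x (x) x)
    = \Delta(m x) J. *)
Lemma twist_module_gauge (J J' : grpalg k (gT * gT)%type) x m :
  x \is a GRing.unit -> counit x = 1 ->
  J' = coprod x * J * tens x^-1 x^-1 ->
  twist_module J' m -> twist_module J (conv m x).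
Proof.
move=> ux x1 eqJ /twist_moduleE[mM m1]; apply/twist_moduleE; split; last first.
  by rewrite sum_conv x1 scale1r.
have eqJ' : coprod x * J = J' * tens x x.
  by rewrite eqJ -mulrA -tensM mulVr // tens1 mulr1.
rewrite -conv_diag_coprod -convM eqJ' convM -mM.
by apply/funext => -[g h]; rewrite conv_box_tens.
Qed.

End ConvolutionMatrices.

(** * From twists to projective representations *)

Section Realization.
Local Open Scope ring_scope.

Variables (k : closedFieldType) (gT : finGroupType).
Local Notation H2 := (grpalg k (gT * gT)%type).

(** The pair V is attached to J when A_J has a simple module whose translates
    by elements h of the group of V are isomorphic to it through the operators
    of V. *)
Definition realizes (J : H2) (V : proj_pair k gT) : Prop :=
  exists m : gT -> 'M[k]_(pp_dim V),
    [/\ twist_module J m, proj_irreducible [set: gT] m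
      & {in pp_group V, forall h, intertwines m h (pp_repr V h)}].

Lemma unitmx_neq0 n (A : 'M[k]_n) : (0 < n)%N -> A \in unitmx -> A != 0.
Proof.
by rewrite -row_free_unit -row_leq_rank -mxrank_eq0 -lt0n; apply: leq_trans.
Qed.

(** The group of the pair lies in the stabilizer, which has the same order. *)
Lemma stabilizer_realized J n (m : gT -> 'M[k]_n) (K : {group gT}) rho :
  twist J -> twist_module J m -> proj_irreducible [set: gT] m ->
  proj_repr K rho -> (n ^ 2 = #|K|)%N ->
  {in K, forall h, intertwines m h (rho h)} -> stabilizer m = K :> {set gT}.
Proof.
move=> twJ modm irrm [urho _] cardK irho; apply/esym/eqP.
rewrite eqEcard (card_stabilizer twJ modm irrm) -cardK mulnn leqnn andbT.
apply/fintype.subsetP => h Kh; apply/stabilizerP.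
by exists (rho h); [apply: urho|apply: irho].
Qed.

(** Take a simple module, its stabilizer, and the intertwiners indexed by it:
    they form a projective representation by Schur's lemma, irreducible since
    they span all matrices, of a group of order n^2 with n prime to p. *)
Lemma realizes_exists p (J : H2) : p \in [pchar k] -> twist J ->
  exists2 V, admissible_pair p V & realizes J V.
Proof.
move=> pk twJ; have [n [m [modm irrm]]] := irreducible_module_exists twJ.
have n_gt0 := irrm.1.
have [Q [uQ iQ]] := stabilizer_choice m.
have cardK := card_stabilizer twJ modm irrm.
exists (ProjPair (stabilizer_group m) Q); last by exists m.
split=> /=.
- have p_pr := pcharf_prime pk.
  rewrite /pgroup cardK p'natE // (Euclid_dvdM _ _ p_pr) orbb.
  by rewrite (dvdn_pcharf pk) (dim_neq0 twJ modm irrm).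
- split=> // x y Kx Ky; have Kxy := groupM Kx Ky.
  have [a Qa] := intertwines_scalar irrm (uQ _ Kxy) (iQ _ Kxy)
    (intertwinesM (iQ _ Kx) (iQ _ Ky)).
  exists a => //; have : Q x *m Q y != 0.
    by apply: unitmx_neq0; rewrite ?unitmx_mul ?uQ.
  by apply: contraNneq => a0; rewrite Qa a0 scale0r.
- exact: span_irreducible (stabilizer_span twJ modm irrm uQ iQ).
- by rewrite cardK mulnn.
Qed.

Lemma realizes_gauge (J J' : H2) V :
  gauge_equiv J J' -> realizes J' V -> realizes J V.
Proof.
move=> [x [ux x1 eqJ]] [m [modm irrm iV]]; exists (conv m x); split.
- exact: twist_module_gauge eqJ modm.
- split=> [|U stabU U0]; first exact: irrm.1.
  apply: irrm.2 => // c _; rewrite -[m]conv1 -(mulrV ux) convM.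
  rewrite mulmx_sumr summx_sub // => g _; rewrite -scalemxAr scalemx_sub //.
  by apply: stabU; apply: finset.in_setT.
- move=> h Kh c; rewrite mulmx_suml mulmx_sumr (reindex_inj (mulgI h)) /=.
  apply: eq_bigr => g _; rewrite -scalemxAl -scalemxAr iV //.
  by rewrite invMg -mulgA mulKg.
Qed.

Lemma realizes_pair_equiv p (J : H2) V W : admissible_pair p W ->
  realizes J V -> pair_equiv V W -> realizes J W.
Proof.
case: W V => [L d sigma] [K n rho] /= [_ [usigma _] _ _] /= [m [modm irrm iV]].
move=> [g [/= defL [P [eqn freeP isoP]]]]; subst d.
have uP : P \in unitmx by rewrite -row_free_unit.
exists (fun c => invmx P *m m (g^-1 * c)%g *m P); split=> /=.
- apply: twist_module_conj (twist_module_translate _ modm); first exact: mulmxV.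
  exact: mulVmx.
- split=> [|U stabU U0]; first exact: irrm.1.
  have : row_full (U *m invmx P).
    apply: irrm.2 => [c _|]; last first.
      by apply: contraNneq U0 => U0; rewrite -(mulmxKV uP U) U0 mul0mx.
    have := stabU (g * c)%g (finset.in_setT _).
    rewrite mulKg !mulmxA => stabUc.
    by rewrite -(submxMfree _ _ freeP) mulmxKV.
  by rewrite /row_full mxrankMfree // row_free_unit unitmx_inv.
- move=> h Lh c /=.
  have Khg : (h ^ g)%g \in K.
    by move: Lh; rewrite defL mem_conjg invgK.
  have [a a0 Pa] := isoP h Lh.
  have sigmaE : sigma h = a^-1 *: (invmx P *m rho (h ^ g)%g *m P).
    rewrite -[LHS](mulKmx uP) -[P *m _](scalerK a0) -Pa -scalemxAr.
    by rewrite mulmxA.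
  have -> : (g^-1 * (h * c) = h ^ g * (g^-1 * c))%g.
    by rewrite conjgE -!mulgA mulKVg.
  rewrite sigmaE -scalemxAr -scalemxAl; congr (_ *: _).
  by rewrite !mulmxA !(mulmxK uP) -(mulmxA (invmx P)) iV //= !mulmxA.
Qed.

(** The two simple modules are related by some translation g and an invertible
    P. These carry intertwiners of the first module to intertwiners of the
    second one, hence conjugate one stabilizer into the other and match the
    projective representations up to scalars. *)
Lemma realizes_unique p (J : H2) V W : twist J ->
  admissible_pair p V -> admissible_pair p W ->
  realizes J V -> realizes J W -> pair_equiv V W.
Proof.
move=> twJ; case: W V => [L d sigma] [K n rho] /=.
move=> [_ /= Krho _ cardK] [_ /= Lsigma _ cardL].
move=> [/= m [modm irrm im]] [/= m' [modm' irrm' im']].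
have n_gt0 := irrm.1.
have d_gt0 := irrm'.1.
pose X : 'M[k]_(n, d) := const_mx 1.
have X0 : X != 0.
  apply/eqP => /matrixP/(_ (Ordinal n_gt0) (Ordinal d_gt0)).
  by rewrite !mxE => /eqP; rewrite oner_eq0.
have [g P0] : exists g, twist_avg J m (fun c => m' (g * c)%g) X != 0.
  apply/existsP; apply: contraNT X0 => /existsPn allP0.
  rewrite -(twist_avg_translates twJ X modm modm') big1 // => g _.
  by apply/eqP; move: (allP0 g); rewrite negbK.
set P := twist_avg _ _ _ _ in P0.
have mP c : m c *m P = P *m m' (g * c)%g.
  apply: (@twist_avg_intertwines _ _ _ twJ) => //.
  exact: twist_module_translate.
have [freeP fullP] := schur_unit irrm (irreducible_translate g irrm')
  (fun c _ => mP c) P0.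
have eqnd : n = d.
  by move: freeP fullP; rewrite /row_free /row_full => /eqP-> /eqP.
clearbody P; clear X X0; subst d.
have uP : P \in unitmx by rewrite -row_free_unit.
have m'E c : m' (g * c)%g = invmx P *m m c *m P.
  by rewrite -mulmxA mP mulKmx.
have iK h : h \in K ->
    intertwines m' (h ^ g^-1)%g (invmx P *m rho h *m P).
  move=> Kh c; rewrite conjgE invgK -{2}(mulKVg g c) -!mulgA !m'E.
  by rewrite !mulmxA !(mulmxK uP) -(mulmxA (invmx P)) im //= !mulmxA.
have uK h : h \in K -> invmx P *m rho h *m P \in unitmx.
  by move=> Kh; rewrite !unitmx_mul unitmx_inv uP Krho.1.
have defL : L = (K :^ g^-1)%g :> {set gT}.
  apply/esym/eqP; rewrite eqEcard cardJg -cardL cardK leqnn andbT.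
  rewrite -(stabilizer_realized twJ modm' irrm' Lsigma cardL im').
  apply/fintype.subsetP => _ /imsetP[h Kh ->]; apply/stabilizerP.
  by exists (invmx P *m rho h *m P); [apply: uK|apply: iK].
exists g; split=> //=; exists P; split=> // x Lx.
have Kxg : (x ^ g)%g \in K by move: Lx; rewrite defL mem_conjg invgK.
have := iK _ Kxg; rewrite conjgK => ix.
have [a Pa] := intertwines_scalar irrm' (Lsigma.1 _ Lx) (im' _ Lx) ix.
exists a; last by rewrite scalemxAr -Pa !mulmxA mulmxV // mul1mx.
have := unitmx_neq0 n_gt0 (uK _ Kxg).
by apply: contraNneq => a0; rewrite Pa a0 scale0r.
Qed.

End Realization.

(** * Cyclic vectors from rank inequalities *)

Section NormalBasis.
Local Open Scope ring_scope.

Variables (k : fieldType) (gT : finGroupType) (K : {group gT}) (N : nat).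
Variable rG : mx_representation k K N.
Local Notation aG := (regular_repr k K).

(** The matrix of the homomorphism from the regular module that sends 1 to c. *)
Definition orbit_mx (c : 'rV[k]_N) : 'M[k]_(#|K|, N) :=
  \matrix_i (c *m rG (enum_val i)).

Lemma mul_orbit_mx (c : 'rV_N) (r : 'rV_#|K|) :
  r *m orbit_mx c = c *m gring_mx rG r.
Proof.
rewrite /gring_mx /= mulmx_sum_row (mulmx_sum_row r) linear_sum mulmx_sumr.
by apply: eq_bigr => i _; rewrite linearZ /= !rowK mxvecK -scalemxAr.
Qed.

Lemma orbit_mx_hom c x : x \in K -> aG x *m orbit_mx c = orbit_mx c *m rG x.
Proof.
move=> Kx; apply/row_matrixP => i.
rewrite rowE mulmxA mul_orbit_mx gring_mxJ // mulmxA -mul_orbit_mx.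
by rewrite -mulmxA -rowE.
Qed.

Lemma orbit_mx_module c : mxmodule rG (orbit_mx c).
Proof. by apply/mxmoduleP => x Kx; rewrite -orbit_mx_hom // submxMl. Qed.

Let u1 : 'rV[k]_#|K| := gring_row 1%:M.

Let u1_mul (A : 'M[k]_#|K|) : u1 *m A = gring_row A.
Proof. by rewrite -gring_row_mul mul1mx. Qed.

Let gring_mx_u1 : gring_mx rG u1 = 1%:M.
Proof. by rewrite -gring_opE gring_op1. Qed.

Lemma orbit_mx_sub c : (c <= orbit_mx c)%MS.
Proof.
by rewrite -[X in (X <= _)%MS](mulmx1 c) -gring_mx_u1 -mul_orbit_mx submxMl.
Qed.

Lemma orbit_mx_min m c (U : 'M_(m, N)) :
  mxmodule rG U -> (c <= U)%MS -> (orbit_mx c <= U)%MS.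
Proof.
move=> modU cU; apply/row_subP => i; rewrite rowK.
apply: submx_trans (submxMr _ cU) _.
by apply: (mxmoduleP modU); apply: enum_valP.
Qed.

(** In Grothendieck group terms the ranks say that every simple module occurs
    in rG at least as often as in the regular module. Choose c with an orbit
    of maximal rank. By Maschke's theorem the right ideal L of relations of c
    is generated by an idempotent e, and the orbit of c has a complement U'.
    If some u in U' had u e != 0, then c + u e would have a larger orbit, so
    e kills U'. Then the image of e on the module is the image under the orbit
    map of the left ideal generated by e; as e itself is a relation of c, this
    image is smaller than that ideal unless e = 0. *)
Lemma cyclic_vector_exists : ([pchar k]^'.-group K)%g -> #|K| = N ->
  (forall a, (\rank (gring_mx aG a) <= \rank (gring_mx rG a))%N) ->
  exists c, row_free (orbit_mx c).
Proof.
move=> p'K cardK rankE.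
pose P r := `[< exists c, \rank (orbit_mx c) = r >].
have exP : exists r, P r.
  by exists (\rank (orbit_mx 0)); apply/asboolP; exists 0.
have maxP r : P r -> (r <= #|K|)%N.
  by move=> /asboolP[c <-]; apply: rank_leq_row.
case: (ex_maxnP exP maxP) => r /asboolP[c rc] max_r.
exists c; apply: contraT => not_free.
pose L := kermx (orbit_mx c).
have modL : mxmodule aG L.
  apply/mxmoduleP => x Kx; apply/sub_kermxP.
  by rewrite -mulmxA orbit_mx_hom // mulmxA mulmx_ker mul0mx.
have [L' modL' defL dxL] := mx_Maschke_pchar aG p'K modL (submx1 _).
have /sub_addsmxP[[v v'] /= u1E] : (u1 <= L + L')%MS by rewrite defL submx1.
pose e := v *m L.
have eL : (e <= L)%MS by apply: submxMl.
have e'L : (v' *m L' <= L')%MS by apply: submxMl.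
have eM s : (s <= L)%MS -> e *m gring_mx aG s = s.
  move=> sL; have sE : s = e *m gring_mx aG s + v' *m L' *m gring_mx aG s.
    by rewrite -mulmxDl -u1E u1_mul gring_mxK.
  have sL1 := mxmodule_envelop modL (gring_mxP aG s) eL.
  have sL2 := mxmodule_envelop modL' (gring_mxP aG s) e'L.
  apply/esym/eqP; rewrite -subr_eq0 -submx0.
  have -> : (0 : 'M_(#|K|)) = (0 : 'M_#|K|) by [].
  rewrite -(mxdirect_addsP dxL) sub_capmx addmx_sub ?eqmx_opp //=.
  by rewrite {1}sE addrC addKr.
have e0 : e != 0.
  apply: contraNneq not_free => e0; rewrite -kermx_eq0 -submx0.
  by apply/row_subP => i; rewrite -(eM _ (row_sub i L)) e0 mul0mx sub0mx.
pose Th := gring_mx rG e.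
have cTh : c *m Th = 0.
  by rewrite -mul_orbit_mx; apply/sub_kermxP.
have ThTh : Th *m Th = Th by rewrite -gring_mxA eM.
have modU : mxmodule rG <<orbit_mx c>>%MS.
  by rewrite (eqmx_module _ (genmxE _)) orbit_mx_module.
have [U' modU' defU dxU] := mx_Maschke_pchar rG p'K modU (submx1 _).
have U'Th : U' *m Th = 0.
  apply/eqP; rewrite -submx0; apply/row_subP => i; rewrite submx0.
  set c' := row i _.
  have c'U' : (c' <= U')%MS.
    apply: submx_trans (row_sub _ _) _.
    by apply: mxmodule_envelop modU' (gring_mxP rG e) _.
  have c'Th : c' *m Th = c' by rewrite /c' !row_mul -mulmxA ThTh.
  have c'1 : (c' <= orbit_mx (c + c'))%MS.
    by apply/submxP; exists e; rewrite mul_orbit_mx mulmxDl cTh add0r c'Th.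
  have c1 : (c <= orbit_mx (c + c'))%MS.
    by rewrite -[X in (X <= _)%MS](addrK c') addmx_sub ?eqmx_opp ?orbit_mx_sub.
  have sub1 : (orbit_mx c <= orbit_mx (c + c'))%MS.
    by apply: orbit_mx_min c1; apply: orbit_mx_module.
  have sub2 : (orbit_mx (c + c') <= orbit_mx c)%MS.
    rewrite -(geq_leqif (mxrank_leqif_sup sub1)) rc max_r //.
    by apply/asboolP; exists (c + c').
  rewrite -submx0 -(mxdirect_addsP dxU) sub_capmx c'U' andbT genmxE.
  exact: submx_trans c'1 sub2.
have ThE : (Th <= gring_mx aG e *m orbit_mx c)%MS.
  rewrite -[X in (X <= _)%MS]mul1mx.
  apply: submx_trans (submxMr Th (_ : (_ <= <<orbit_mx c>> + U')%MS)) _.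
    by rewrite defU submx1.
  rewrite addsmxMr U'Th addsmx_sub sub0mx andbT.
  rewrite (eqmxMr _ (genmxE _)); apply/row_subP => i.
  rewrite row_mul rowE mul_orbit_mx -mulmxA -gring_mxA -mul_orbit_mx -mulmxA.
  exact: submxMl.
have := mxrankS ThE; rewrite leqNgt => /negP[].
apply: leq_trans (rankE e).
rewrite -(mxrank_mul_ker (gring_mx aG e) (orbit_mx c)).
rewrite -addn1 leq_add2l lt0n mxrank_eq0.
apply: contraNneq e0 => cap0; rewrite -submx0 -cap0 sub_capmx eL andbT.
by rewrite -[X in (X <= _)%MS](gring_mxK e) -u1_mul submxMl.
Qed.

End NormalBasis.

(** * Projective representations of central type *)

Lemma mul_delta_entry (R : pzRingType) m n p q
    (A : 'M[R]_(m, n)) (B : 'M_(p, q)) i j l b :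
  ((A *m delta_mx j l *m B) i b = A i j * B l b)%R.
Proof.
rewrite -(mul_delta_mx (ord0 : 'I_1)) mulmxA -colE -mulmxA -rowE mxE.
by rewrite big_ord1 !mxE.
Qed.

Lemma mul_delta_delta (R : pzRingType) m n p q (A : 'M[R]_(n, p))
    (i : 'I_m) j l (i' : 'I_q) :
  (delta_mx i j *m A *m delta_mx l i' = A j l *: delta_mx i i')%R.
Proof.
rewrite -[LHS]mulmx1; apply/matrixP => x y.
rewrite mul_delta_entry -[delta_mx i j]mul1mx mul_delta_entry !mxE (eq_sym y).
by case: (x == i); case: (i' == y); rewrite ?(mul1r, mulr1, mul0r, mulr0).
Qed.

Lemma mxtrace_delta (R : pzRingType) n (i j : 'I_n) :
  (\tr (delta_mx i j : 'M[R]_n) = (i == j)%:R)%R.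
Proof.
rewrite /mxtrace (bigD1 i) //= mxE eqxx big1 ?addr0 // => l /negPf li.
by rewrite mxE li.
Qed.

Section CentralType.
Local Open Scope ring_scope.

Variables (k : closedFieldType) (gT : finGroupType) (K : {group gT}) (n : nat).
Variable rho : gT -> 'M[k]_n.
Hypotheses (Krho : proj_repr K rho) (irr : proj_irreducible K rho).
Hypotheses (cardK : (n ^ 2 = #|K|)%N) (n_neq0 : n%:R != 0 :> k).

Let n_gt0 : (0 < n)%N := irr.1.
Let urho h : h \in K -> rho h \in unitmx. Proof. exact: Krho.1. Qed.

(** The scalars of the projective representation cancel here, so that this is
    an honest linear action of K on the matrix algebra. *)
Definition proj_conj h (X : 'M[k]_n) := rho h *m X *m invmx (rho h).

Lemma proj_conj_is_linear h : linear (proj_conj h).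
Proof.
by move=> a X Y; rewrite /proj_conj mulmxDr mulmxDl -scalemxAr -scalemxAl.
Qed.
HB.instance Definition _ h := GRing.isLinear.Build k 'M_n 'M_n _ (proj_conj h)
  (proj_conj_is_linear h).

Lemma proj_conjM x y X : x \in K -> y \in K ->
  proj_conj (x * y)%g X = proj_conj x (proj_conj y X).
Proof.
move=> Kx Ky; have [c c0 rhoM] := Krho.2 _ _ Kx Ky.
have rhoE : rho (x * y)%g = c^-1 *: (rho x *m rho y).
  by rewrite rhoM scalerA mulVf // scale1r.
have uxy : rho x *m rho y \in unitmx by rewrite unitmx_mul !urho.
rewrite /proj_conj rhoE invmxZ ?unitmxZ ?unitfE ?invr_eq0 //.
rewrite -scalemxAr -!scalemxAl scalerA invrK mulfV // scale1r.
apply: (can_inj (mulmxK uxy)).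
by rewrite mulmxKV // !mulmxA mulmxKV ?urho // mulmxKV ?urho.
Qed.

Lemma proj_conj_inj h : h \in K -> injective (proj_conj h).
Proof.
move=> Kh; apply: can_inj (fun Y => invmx (rho h) *m Y *m rho h) _ => X.
by rewrite /proj_conj !mulmxA mulVmx ?urho // mul1mx mulmxKV ?urho.
Qed.

Lemma proj_conj1 X : proj_conj 1%g X = X.
Proof.
by apply: (proj_conj_inj (group1 K)); rewrite -proj_conjM ?group1 // mulg1.
Qed.

Lemma proj_conj_mul h X Y : h \in K ->
  proj_conj h (X *m Y) = proj_conj h X *m proj_conj h Y.
Proof. by move=> Kh; rewrite /proj_conj !mulmxA mulmxKV ?urho. Qed.

Lemma mxtrace_proj_conj h X : h \in K -> \tr (proj_conj h X) = \tr X.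
Proof. by move=> Kh; rewrite /proj_conj mxtrace_mulC mulKmx ?urho. Qed.

(** The sum is a scalar by Schur's lemma, found by taking traces; this uses
    |K| = n^2 and that n is invertible in k. *)
Lemma proj_conj_orthogonality X :
  \sum_(h in K) proj_conj h X = (n%:R * \tr X)%:M.
Proof.
have [x Kx|a TE] := schur_scalar (P := \sum_(h in K) proj_conj h X) irr.
  rewrite mulmx_sumr mulmx_suml [RHS](reindex_inj (mulgI x)) /=.
  apply: eq_big => h; first by rewrite groupMl.
  move=> Kh; rewrite proj_conjM // /proj_conj -[in RHS]mulmxA.
  by rewrite mulVmx ?urho // mulmx1.
rewrite TE; congr _%:M; apply: (mulfI n_neq0).
have /(congr1 mxtrace) := TE; rewrite mxtrace_scalar raddf_sum /=.
under eq_bigr do rewrite mxtrace_proj_conj //.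
rewrite sumr_const -cardK => trE.
by rewrite [LHS]mulr_natl -trE mulrA -natrM mulnn mulr_natl.
Qed.

(** The coefficients come from [proj_conj_orthogonality] on matrix units. *)
Lemma proj_repr_span X : exists a : gT -> k, X = \sum_(h in K) a h *: rho h.
Proof.
exists (fun h => n%:R^-1 * \tr (X *m invmx (rho h))).
apply/matrixP => i j; rewrite summxE; apply: (can_inj (mulKf n_neq0)).
transitivity (\sum_b \sum_l X b l *
   (\sum_(h in K) proj_conj h (delta_mx j l)) i b).
  under eq_bigr do under eq_bigr do
    rewrite proj_conj_orthogonality !mxE mxtrace_delta.
  rewrite (bigD1 i) //= (bigD1 j) //= !eqxx mulr1n mulr1 mulrC.
  rewrite big1 ?addr0 => [|l lj]; last first.
    by rewrite eq_sym (negPf lj) mulr0 mul0rn mulr0.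
  rewrite big1 ?addr0 // => b bi; rewrite big1 // => l _.
  by rewrite (eq_sym i b) (negPf bi) mulr0n mulr0.
rewrite mulr_sumr.
under [RHS]eq_bigr do rewrite mxE mulrA mulVKf // mulr_suml.
rewrite [RHS]exchange_big /=; apply: eq_bigr => b _.
under [RHS]eq_bigr do rewrite mxE mulr_suml.
rewrite [RHS]exchange_big /=; apply: eq_bigr => l _.
rewrite summxE mulr_sumr; apply: eq_bigr => h Kh.
by rewrite /proj_conj mul_delta_entry mulrA mulrAC.
Qed.

Lemma family_mx_proj_repr :
  row_free (family_mx K rho) /\ row_full (family_mx K rho).
Proof.
have full : row_full (family_mx K rho) by apply: family_mx_full proj_repr_span.
by split=> //; rewrite /row_free (eqP full) -cardK mulnn.
Qed.

(** The inverse turns the left action [proj_conj] into a right action on row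
    vectors. *)
Definition conj_mx h : 'M[k]_(n * n) := lin_mx (proj_conj h^-1%g).

Lemma conj_mx_repr : mx_repr K conj_mx.
Proof.
split=> [|x y Kx Ky].
  apply/row_matrixP => i; rewrite rowE mul_rV_lin /= invg1 proj_conj1 vec_mxK.
  by rewrite row1.
apply/row_matrixP => i; rewrite !rowE mulmxA !mul_rV_lin /= mxvecK invMg.
by rewrite proj_conjM ?groupV.
Qed.
Canonical conj_repr := MxRepresentation conj_mx_repr.

Lemma mul_conj_mx X h : mxvec X *m conj_mx h = mxvec (proj_conj h^-1%g X).
Proof. by rewrite mul_vec_lin. Qed.

(** The function h |-> b (h c) from K to the matrix algebra, as a matrix with
    one row for each h. *)
Definition galois_mx (b c : 'M[k]_n) : 'M[k]_(#|K|, n * n) :=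
  \matrix_i mxvec (b *m proj_conj (enum_val i) c).

Lemma galois_mx_is_linear b : linear (galois_mx b).
Proof.
move=> a c d; apply/row_matrixP => t.
by rewrite [RHS]linearP /= !rowK linearP /= mulmxDr -scalemxAr linearP.
Qed.
HB.instance Definition _ b := GRing.isLinear.Build k 'M_n 'M_(#|K|, n * n) _
  (galois_mx b) (galois_mx_is_linear b).

Lemma galois_mx_linearl a b b' c :
  galois_mx (a *: b + b') c = a *: galois_mx b c + galois_mx b' c.
Proof.
apply/row_matrixP => t.
by rewrite [RHS]linearP /= !rowK mulmxDl -scalemxAl linearP.
Qed.

Lemma galois_mx_scale a b c : galois_mx (a *: b) c = a *: galois_mx b c.
Proof.
by apply/row_matrixP => t; rewrite [RHS]linearZ /= !rowK -scalemxAl linearZ.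
Qed.

Lemma regular_mx_tr g : g \in K ->
  (regular_mx k K g)^T = regular_mx k K g^-1%g.
Proof.
move=> Kg; apply/matrixP => t s; rewrite !mxE !eqxx /=.
congr ((nat_of_bool _)%:R).
rewrite -!(inj_eq enum_val_inj) !gring_indexK ?groupM ?groupV ?enum_valP //.
by rewrite -(inj_eq (mulIg g) (enum_val s)) mulgKV eq_sym.
Qed.

Lemma gring_mxE m (rG : mx_representation k K m) (a : 'rV_#|K|) :
  gring_mx rG a = \sum_i a 0 i *: rG (enum_val i).
Proof.
rewrite /gring_mx /= mulmx_sum_row linear_sum; apply: eq_bigr => i _.
by rewrite linearZ /= rowK mxvecK.
Qed.

(** On the functions h |-> b (h c), an element of the group algebra acting on
    the argument h is the same element acting on c. *)
Lemma regular_galois_mx (a : 'rV_#|K|) b c :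
  (gring_mx (regular_repr k K) a)^T *m galois_mx b c
  = galois_mx b (vec_mx (mxvec c *m gring_mx conj_repr a)).
Proof.
rewrite !gring_mxE linear_sum mulmx_suml mulmx_sumr !linear_sum.
apply: eq_bigr => i _; rewrite linearZ -scalemxAl -scalemxAr !linearZ /=.
congr (_ *: _); rewrite regular_mx_tr ?enum_valP // mul_conj_mx mxvecK.
apply/row_matrixP => t; rewrite row_mul rowK -rowE !rowK.
rewrite gring_indexK ?groupM ?groupV ?enum_valP //.
by rewrite proj_conjM ?groupV ?enum_valP.
Qed.

(** Since proj_conj h c = rho h * c * (rho h)^-1, the claim concerns the
    functions h |-> b (rho h) c. Every linear map on matrices is a sum of maps
    X |-> b X c, and a linear map may take arbitrary values on the independent
    matrices rho h. *)
Lemma galois_mx_onto (F : 'M[k]_(#|K|, n * n)) :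
  exists b : 'I_n -> 'I_n -> 'M[k]_n,
    F = \sum_l \sum_i galois_mx (b l i) (delta_mx l i).
Proof.
have [freeR _] := family_mx_proj_repr.
pose R := family_mx K rho; pose R' := pinvmx R.
have RR' : R *m R' = 1%:M by apply: mulmxVp.
clearbody R'.
pose Y h : 'M_n := vec_mx (row h F) *m rho (enum_val h).
(* R' inverts the family rho, so that X |-> \sum_(j, l) R' (j, l) h * X j l is
   the coordinate at rho h; the entry X j l is isolated by matrix units. *)
pose b l i := \sum_h \sum_j R' (mxvec_index j l) h *: (Y h *m delta_mx i j).
exists b; apply/row_matrixP => t; rewrite linear_sum /=.
have coefE h :
    \sum_l \sum_j R' (mxvec_index j l) h * rho (enum_val t) j l = (t == h)%:R.
  have /matrixP/(_ t h) := RR'; rewrite !mxE => <-.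
  rewrite (reindex _ (curry_mxvec_bij _ _)) /= sum_pair exchange_big /=.
  apply: eq_bigr => l _; apply: eq_bigr => j _.
  by rewrite mxE mxvecE mulrC.
have bE : \sum_l \sum_i b l i *m (rho (enum_val t) *m delta_mx l i) = Y t.
  transitivity (\sum_h (\sum_l \sum_j
      R' (mxvec_index j l) h * rho (enum_val t) j l) *: Y h).
    under [RHS]eq_bigr do rewrite scaler_suml.
    rewrite [RHS]exchange_big /=; apply: eq_bigr => l _.
    under eq_bigr do rewrite mulmx_suml.
    rewrite exchange_big /=; apply: eq_bigr => h _.
    under eq_bigr do rewrite mulmx_suml.
    rewrite exchange_big scaler_suml /=; apply: eq_bigr => j _.
    rewrite -[Y h in RHS]mulmx1 mx1_sum_delta mulmx_sumr scaler_sumr.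
    apply: eq_bigr => i _; rewrite -scalemxAl -scalerA; congr (_ *: _).
    rewrite -mulmxA scalemxAr; congr (_ *m _).
    by rewrite mulmxA mul_delta_delta.
  rewrite (bigD1 t) //= coefE eqxx scale1r big1 ?addr0 // => h /negPf ht.
  by rewrite coefE eq_sym ht scale0r.
have -> : row t F = mxvec (Y t *m invmx (rho (enum_val t))).
  by rewrite mulmxK ?vec_mxK // urho // enum_valP.
rewrite -bE mulmx_suml linear_sum /=; apply: eq_bigr => l _.
rewrite linear_sum /= mulmx_suml linear_sum /=; apply: eq_bigr => i _.
by rewrite rowK /proj_conj !mulmxA.
Qed.

(** Write N = n^2, and let D and E be the actions of a on the matrix algebra
    and on the regular module. By [galois_mx_onto], the tensor product of E^T
    with a space of dimension N has its image in the span of the functions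
    h |-> b (h w) with w in the image of D; comparing dimensions,
    N rank E <= N rank D. *)
Lemma rank_conj_repr (a : 'rV[k]_#|K|) :
  (\rank (gring_mx (regular_repr k K) a) <= \rank (gring_mx conj_repr a))%N.
Proof.
pose D := gring_mx conj_repr a; pose E := gring_mx (regular_repr k K) a.
rewrite -/D -/E -mxrank_tr.
pose w i : 'M_n := vec_mx (row i (row_base D)).
(* The images of Psi are the sums of functions h |-> b (h (w i)). *)
pose Psi (B : 'M[k]_(\rank D, n * n)) : 'M_(#|K|, n * n) :=
  \sum_i galois_mx (vec_mx (row i B)) (w i).
have linPsi : linear Psi.
  move=> s B C; rewrite /Psi scaler_sumr -big_split; apply: eq_bigr => i _ /=.
  by rewrite !linearP /= galois_mx_linearl.
pose Psi_lin := GRing.isLinear.Build _ _ _ _ Psi linPsi.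
pose PsiL : {linear _ -> _} := HB.pack Psi Psi_lin.
have EG b c : (mxvec (E^T *m galois_mx b c) <= lin_mx PsiL)%MS.
  pose lam := mxvec c *m col_base D.
  pose B : 'M_(\rank D, n * n) := \matrix_i (lam 0 i *: mxvec b).
  suff -> : E^T *m galois_mx b c = PsiL B by rewrite -mul_vec_lin submxMl.
  have cD : mxvec c *m D = \sum_i lam 0 i *: row i (row_base D).
    by rewrite -[in LHS](mulmx_base D) mulmxA mulmx_sum_row.
  rewrite regular_galois_mx -/D cD.
  rewrite !linear_sum /= /Psi; apply: eq_bigr => i _.
  by rewrite rowK !linearZ /= mxvecK galois_mx_scale.
have EF F : (mxvec (E^T *m F) <= lin_mx PsiL)%MS.
  have [b ->] := galois_mx_onto F.
  rewrite mulmx_sumr linear_sum summx_sub // => l _.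
  by rewrite mulmx_sumr linear_sum summx_sub // => i _; apply: EG.
pose L1 : 'M_(\rank E^T * (n * n), #|K| * (n * n)) :=
  lin_mx (mulmx (col_base E^T)).
have freeL1 : row_free L1.
  apply: inj_row_free => v; rewrite mul_rV_lin /= => /eqP.
  rewrite mxvec_eq0 => /eqP Ev0.
  apply: (can_inj vec_mxK); rewrite linear0.
  have /row_fullP[X XE] := col_base_full E^T.
  by rewrite -[LHS]mul1mx -XE -mulmxA Ev0 mulmx0.
have L1Psi : (L1 <= lin_mx PsiL)%MS.
  apply/row_subP => i; rewrite rowE mul_rV_lin /=.
  set Z := vec_mx _.
  have [W ->] : exists W, Z = row_base E^T *m W.
    exists (pinvmx (row_base E^T) *m Z).
    by rewrite (mulmxA (row_base _)) mulmxVp ?row_base_free // mul1mx.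
  by rewrite mulmxA mulmx_base; apply: EF.
have := leq_trans (mxrankS L1Psi) (rank_leq_row _).
by rewrite (eqP freeL1) leq_pmul2r // muln_gt0 n_gt0.
Qed.

(** The conjugation action of K on the matrix algebra is the regular
    representation. *)
Lemma normal_basis : ([pchar k]^'.-group K)%g ->
  exists c, row_free (family_mx K (fun h => proj_conj h c)).
Proof.
move=> p'K; have [|v free_v] := cyclic_vector_exists p'K _ rank_conj_repr.
  by rewrite -cardK mulnn.
exists (vec_mx v); apply: family_mx_free => a sum0 h Kh.
pose r : 'rV_#|K| := \row_i a (enum_val i)^-1%g.
have r0 : r = 0.
  apply: (row_free_inj free_v); rewrite mul0mx mul_orbit_mx gring_mxE.
  rewrite mulmx_sumr; move/(congr1 mxvec): sum0; rewrite linear0 => sumE.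
  rewrite -[RHS]sumE [in RHS](reindex_inj invg_inj) /= linear_sum.
  rewrite [RHS](eq_bigl (mem K)) => [|x]; last by rewrite groupV.
  rewrite [RHS]big_enum_val; apply: eq_bigr => i _.
  by rewrite mxE -scalemxAr linearZ /= -mul_conj_mx vec_mxK.
have /rowP/(_ (gring_index K h^-1%g)) := r0.
by rewrite !mxE gring_indexK ?groupV // invgK.
Qed.

(** The form in which the normal basis is used: phi is the coordinate at the
    unit of K, and the other coordinates are obtained from it by conjugation.
    The sum of the orbit of c is a nonzero scalar, normalized to be 1. *)
Lemma equivariant_basis : ([pchar k]^'.-group K)%g ->
  exists c (phi : {linear 'M[k]_n -> k^o}),
    [/\ \sum_(h in K) proj_conj h c = 1%:M,
        {in K, forall h, phi (proj_conj h c) = (h == 1%g)%:R}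
      & forall X, X = \sum_(h in K) phi (proj_conj h^-1%g X) *: proj_conj h c].
Proof.
move=> p'K; have [c0 free0] := normal_basis p'K.
have ntr0 : n%:R * \tr c0 != 0.
  apply/eqP => ntr0; have /= := free0; rewrite -kermx_eq0 => /eqP ker0.
  have : (const_mx 1 : 'rV_#|K|) *m family_mx K (fun h => proj_conj h c0) = 0.
    rewrite mul_family_mx; under eq_bigr do rewrite mxE scale1r.
    by rewrite proj_conj_orthogonality ntr0 !raddf0.
  rewrite -[RHS](mul0mx _ (family_mx K (fun h => proj_conj h c0))).
  move/(row_free_inj free0)/rowP/(_ (gring_index K 1)); rewrite !mxE => /eqP.
  by rewrite oner_eq0.
pose c := (n%:R * \tr c0)^-1 *: c0.
pose F := family_mx K (fun h => proj_conj h c).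
have freeF : row_free F.
  have -> : F = (n%:R * \tr c0)^-1 *: family_mx K (fun h => proj_conj h c0).
    by apply/row_matrixP => i; rewrite linearZ /= !rowK !linearZ.
  by rewrite /row_free mxrank_scale_nz ?invr_eq0.
have fullF : row_full F.
  move: freeF; rewrite /row_free /row_full => /eqP->.
  by rewrite -cardK mulnn.
pose F' := pinvmx F; have FF' : F *m F' = 1%:M by apply: mulmxVp.
clearbody F'.
pose f (X : 'M[k]_n) : k^o := (mxvec X *m F') 0 (gring_index K 1).
have linf : linear f.
  by move=> a X Y; rewrite /f linearP mulmxDl -scalemxAl !mxE.
pose phi_lin := GRing.isLinear.Build k 'M_n k^o _ f linf.
pose phi : {linear 'M[k]_n -> k^o} := HB.pack f phi_lin.
have phic : {in K, forall h, phi (proj_conj h c) = (h == 1%g)%:R}.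
  move=> h Kh; have : mxvec (proj_conj h c) = row (gring_index K h) F.
    by rewrite rowK gring_indexK.
  rewrite /phi /= /f => ->; rewrite -row_mul FF' !mxE.
  by rewrite -(inj_eq enum_val_inj) !gring_indexK.
have sumc : \sum_(h in K) proj_conj h c = 1%:M.
  by rewrite proj_conj_orthogonality mxtraceZ mulrCA mulVf.
clearbody phi; clear f linf phi_lin; clearbody c; exists c, phi; split=> // X.
have [b XE] := family_mx_span X fullF.
rewrite [LHS]XE; apply: eq_bigr => h Kh; congr (_ *: _).
rewrite XE !linear_sum (bigD1 h) //= !linearZ /= -proj_conjM ?groupV //.
rewrite mulVg phic ?group1 // eqxx [_ *: _]mulr1.
rewrite big1 ?addr0 // => g /andP[Kg gh].
rewrite !linearZ /= -proj_conjM ?groupV // phic ?groupM ?groupV //.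
by rewrite -eq_mulVg1 eq_sym (negPf gh) scaler0.
Qed.

End CentralType.

(** * From projective representations to twists *)

Section TwistOfPair.
Local Open Scope ring_scope.

Variables (k : closedFieldType) (gT : finGroupType) (K : {group gT}) (n : nat).
Variable rho : gT -> 'M[k]_n.
Hypotheses (Krho : proj_repr K rho) (irr : proj_irreducible K rho).
Hypotheses (cardK : (n ^ 2 = #|K|)%N) (n_neq0 : n%:R != 0 :> k).
Hypothesis p'K : ([pchar k]^'.-group K)%g.

Let n_gt0 : (0 < n)%N := irr.1.
Let urho h : h \in K -> rho h \in unitmx. Proof. exact: Krho.1. Qed.

(** Extend the orbit basis of the matrix algebra by 0 to a family m over G, and
    let J (a, b) be the coordinate at 1 of m a * m b. By equivariance these
    numbers determine all the coordinates, so that m is a module for J; the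
    twist equation is then the associativity of the product of matrices. *)
Lemma twist_of_pair :
  exists J : grpalg k (gT * gT)%type, exists m : gT -> 'M[k]_n,
  [/\ twist J, twist_module J m, proj_irreducible [set: gT] m
    & {in K, forall h, intertwines m h (rho h)}].
Proof.
have [c [phi [sumc phic expand]]] :=
  equivariant_basis Krho irr cardK n_neq0 p'K.
pose m g : 'M[k]_n := if g \in K then proj_conj rho g c else 0.
have m_conj x g : x \in K -> m (x * g)%g = proj_conj rho x (m g).
  move=> Kx; rewrite /m groupMl //; case: ifP => Kg; last by rewrite linear0.
  exact: (proj_conjM Krho).
have phim g : phi (m g) = (g == 1%g)%:R.
  rewrite /m; case: ifP => [Kg|nKg]; [exact: phic|rewrite linear0].
  by case: eqP nKg => // ->; rewrite group1.
have summ : \sum_g m g = 1%:M by rewrite -sumc -big_mkcond.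
pose J : grpalg k (gT * gT)%type := [ffun u => phi (m u.1 *m m u.2)].
have JE a b : J (a, b) = phi (m a *m m b) by rewrite ffunE.
have mM a b : m a *m m b = \sum_x J (x^-1 * a, x^-1 * b)%g *: m x.
  rewrite [LHS]expand big_mkcond; apply: eq_bigr => x _; rewrite JE /=.
  have [Kx|nKx] := boolP (x \in K); last first.
    by have -> : m x = 0 by [rewrite /m (negPf nKx)]; rewrite scaler0.
  have -> : m x = proj_conj rho x c by rewrite /m Kx.
  by rewrite !m_conj ?groupV // -(proj_conj_mul Krho) ?groupV.
have mod_m : twist_module J m by [].
have phi_ext (Y : 'M[k]_n) (f : gT -> k) :
    \sum_a f a *: m a = Y -> f 1%g = phi Y.
  move=> <-; rewrite linear_sum (bigD1 1%g) //= linearZ /= phim eqxx.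
  rewrite [_ *: _]mulr1 big1 ?addr0 // => a /negPf a1.
  by rewrite linearZ /= phim a1 scaler0.
exists J, m; split=> //; last 2 first.
- apply: span_irreducible => // X.
  exists (fun h => if h \in K then phi (proj_conj rho h^-1%g X) else 0).
  rewrite [LHS]expand big_mkcond.
  apply: eq_big => [x|x _]; first by rewrite finset.in_setT.
  by rewrite /m; case: ifP; rewrite ?scale0r.
- move=> h Kh g; rewrite m_conj // /proj_conj mulmxKV ?urho //.
split.
- apply: ga_unitP => W JW0.
  have box0 s t : \sum_a \sum_b W (a^-1 * s, b^-1 * t)%g *: (m a *m m b) = 0.
    transitivity (conv (box_fun m) W (s, t)); first by rewrite /conv sum_pair.
    have [-> _] := (twist_moduleE J m).1 mod_m.
    by rewrite -convM JW0 /conv big1 // => u _; rewrite ffunE scale0r.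
  apply/ffunP => -[s t]; rewrite [RHS]ffunE.
  pose w a b := W (a^-1 * s, b^-1 * t)%g.
  (* Translating the second argument by h in K inserts rho h in the middle. *)
  have rho0 h : h \in K -> \sum_a \sum_b w a b *: (m a *m rho h *m m b) = 0.
    move=> Kh; rewrite -[RHS](mul0mx _ (rho h)).
    rewrite -[0 in RHS](box0 s (h * t)%g) mulmx_suml.
    apply: eq_bigr => a _; rewrite mulmx_suml [RHS](reindex_inj (mulgI h)) /=.
    apply: eq_bigr => b _; rewrite invMg -mulgA mulKg m_conj //.
    by rewrite -scalemxAl /proj_conj !mulmxA mulmxKV ?urho.
  have X0 X : \sum_a \sum_b w a b *: (m a *m X *m m b) = 0.
    have [r ->] := proj_repr_span Krho irr cardK n_neq0 X.
    transitivity (\sum_(h in K) r h *: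
        \sum_a \sum_b w a b *: (m a *m rho h *m m b)).
      under [RHS]eq_bigr do rewrite scaler_sumr.
      rewrite [RHS]exchange_big /=; apply: eq_bigr => a _.
      under [RHS]eq_bigr do rewrite scaler_sumr.
      rewrite [RHS]exchange_big /=; apply: eq_bigr => b _.
      rewrite mulmx_sumr mulmx_suml scaler_sumr; apply: eq_bigr => h _.
      by rewrite -scalemxAr -scalemxAl !scalerA mulrC.
    by rewrite big1 // => h Kh; rewrite rho0 // scaler0.
  (* The middle factor being arbitrary, the coordinates at 1 of m a and of m b
     can be taken one after the other, which leaves W (s, t). *)
  have right0 : \sum_b w 1%g b *: m b = 0.
    apply/matrixP => j y; rewrite summxE mxE.
    under eq_bigr do rewrite mxE.
    rewrite (phi_ext 0 (fun a => \sum_b w a b * m b j y)) ?linear0 //.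
    apply/matrixP => x i; rewrite summxE.
    have /matrixP/(_ x y) := X0 (delta_mx i j); rewrite !summxE mxE => X0E.
    rewrite mxE -[RHS]X0E; apply: eq_bigr => a _.
    rewrite summxE mxE mulr_suml; apply: eq_bigr => b _.
    by rewrite mxE mul_delta_entry -mulrA (mulrC (m b j y)).
  have := phi_ext 0 (w 1%g) right0; rewrite linear0 /w invg1 !mul1g.
  by [].
- apply/twist_eq_coord => a b d.
  transitivity (phi (m a *m m b *m m d)).
    rewrite mM mulmx_suml linear_sum; apply: eq_bigr => x _.
    by rewrite -scalemxAl linearZ JE mulrC.
  rewrite -mulmxA mM mulmx_sumr linear_sum; apply: eq_bigr => x _.
  by rewrite -scalemxAr linearZ [in RHS]JE mulrC.
- apply/ffunP => v; rewrite counit_idE ga_oneE -phim -[m v in RHS]mul1mx -summ.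
  by rewrite mulmx_suml linear_sum; apply: eq_bigr => u _; rewrite JE.
- apply/ffunP => u; rewrite id_counitE ga_oneE -phim -[m u in RHS]mulmx1 -summ.
  by rewrite mulmx_sumr linear_sum; apply: eq_bigr => v _; rewrite JE.
Qed.

End TwistOfPair.

(** * The correspondence *)

Section Correspondence.
Local Open Scope ring_scope.

Variables (k : closedFieldType) (p : nat) (gT : finGroupType).
Hypothesis pk : p \in [pchar k].
Local Notation H2 := (grpalg k (gT * gT)%type).

Lemma admissible_pchar (V : proj_pair k gT) : admissible_pair p V ->
  ((pp_dim V)%:R != 0 :> k) /\ ([pchar k]^'.-group (pp_group V))%g.
Proof.
move=> [p'K _ _ dimV]; split; last first.
  by rewrite (eq_pgroup _ (eq_negn (pcharf_eq pk))).
rewrite -(dvdn_pcharf pk); apply: contraL p'K => pn.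
rewrite /pgroup -dimV p'natE ?(pcharf_prime pk) // negbK.
by rewrite -mulnn dvdn_mulr.
Qed.

Lemma pair_realized (V : proj_pair k gT) : admissible_pair p V ->
  exists2 J : H2, twist J & realizes J V.
Proof.
move=> admV; have [n0 p'K] := admissible_pchar admV.
have [_ rep irr dimV] := admV.
have [J [m [twJ modm irrm im]]] := twist_of_pair rep irr dimV n0 p'K.
by exists J => //; exists m.
Qed.

(** A linear form phi on matrices with K-orbit a basis of the dual turns
    equivariant functions from G to matrices into functions on G, injectively.
    Applied to the two modules it gives units s and s' of k[G], and
    x = s'^-1 s satisfies m = m' x, which forces the gauge equivalence as the
    translates of m' are jointly faithful. *)
Lemma realizes_gauge_unique (J J' : H2) V :
  twist J -> twist J' -> admissible_pair p V ->
  realizes J V -> realizes J' V -> gauge_equiv J J'.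
Proof.
move=> twJ twJ' admV; have [n0 p'K] := admissible_pchar admV.
have [_ rep irr dimV] := admV; have n_gt0 := irr.1.
case: V {admV} n0 p'K rep irr dimV n_gt0.
move=> K n rho /= n0 p'K rep irr dimV n_gt0.
move=> [/= m [modm _ im]] [/= m' [modm' _ im']].
have [c [phi [_ _ expand]]] := equivariant_basis rep irr dimV n0 p'K.
pose equivariant (F : gT -> 'M[k]_n) :=
  {in K, forall h g, F (h * g)%g = proj_conj rho h (F g)}.
have eqv m1 : {in K, forall h, intertwines m1 h (rho h)} -> equivariant m1.
  by move=> i1 h Kh g; rewrite /proj_conj -i1 // mulmxK ?rep.1.
have eqv_conv m1 y : equivariant m1 -> equivariant (conv m1 y).
  move=> e1 h Kh g; rewrite /conv linear_sum (reindex_inj (mulgI h)) /=.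
  by apply: eq_bigr => l _; rewrite linearZ /= e1 // invMg -mulgA mulKg.
have phi0 F : equivariant F -> (forall g, phi (F g) = 0) -> forall g, F g = 0.
  move=> eF F0 g; rewrite [LHS]expand big1 // => h Kh.
  by rewrite -eF ?groupV // F0 scale0r.
pose s (m1 : gT -> 'M[k]_n) : grpalg k gT := [ffun g => phi (m1 g)].
have sM m1 y g : (s m1 * y) g = phi (conv m1 y g).
  rewrite ga_mulE /conv linear_sum; apply: eq_bigr => h _.
  by rewrite linearZ ffunE mulrC.
have s_unit J1 m1 : twist J1 -> twist_module J1 m1 -> equivariant m1 ->
    s m1 \is a GRing.unit.
  move=> tw1 mod1 e1; apply: ga_unitP => y sy0.
  apply: (conv_inj n_gt0 tw1 mod1); apply: phi0; first exact: eqv_conv.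
  by move=> g; rewrite -sM sy0 ffunE.
have em := eqv _ im; have em' := eqv _ im'.
have us := s_unit _ _ twJ modm em; have us' := s_unit _ _ twJ' modm' em'.
pose x := (s m')^-1 * s m.
have ux : x \is a GRing.unit by rewrite unitrMl ?unitrV.
have mx : conv m' x = m.
  apply/funext => g; apply/eqP; rewrite -subr_eq0; apply/eqP; move: g.
  apply: phi0 => [h Kh g|g].
    by rewrite em // (eqv_conv _ x em') // linearB.
  by rewrite linearB /= -sM mulrA mulrV // mul1r ffunE subrr.
clearbody x.
exists x; split=> //.
  have : counit x *: (1%:M : 'M[k]_n) = 1%:M.
    by rewrite -[in LHS](modm'.2) -sum_conv mx modm.2.
  move/matrixP/(_ (Ordinal n_gt0) (Ordinal n_gt0)).
  by rewrite !mxE eqxx mulr1.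
have [box _] := (twist_moduleE J m).1 modm.
have [box' _] := (twist_moduleE J' m').1 modm'.
have : J' * tens x x - coprod x * J = 0.
  apply: (conv_diag_inj n_gt0 twJ' modm') => -[g h].
  rewrite convB !convM -box' conv_diag_coprod mx -box conv_box_tens mx.
  by rewrite /box_fun subrr.
move/eqP; rewrite subr_eq0 => /eqP <-.
by rewrite -mulrA -tensM mulrV // tens1 mulr1.
Qed.

Lemma gauge_equiv_refl (J : H2) : gauge_equiv J J.
Proof.
exists 1; rewrite unitr1 counit1 coprod1 invr1 tens1 mul1r mulr1.
by split.
Qed.

Lemma gauge_equiv_sym (J J' : H2) : gauge_equiv J J' -> gauge_equiv J' J.
Proof.
move=> [x [ux x1 ->]]; exists x^-1; split; rewrite ?unitrV //.
  by rewrite -[LHS]mul1r -{1}x1 -counitM mulrV // counit1.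
rewrite invrK !mulrA -coprodM mulVr // coprod1 mul1r -mulrA -tensM mulVr //.
by rewrite tens1 mulr1.
Qed.

Lemma gauge_equiv_trans (J1 J2 J3 : H2) :
  gauge_equiv J1 J2 -> gauge_equiv J2 J3 -> gauge_equiv J1 J3.
Proof.
move=> [x [ux x1 ->]] [y [uy y1 ->]]; exists (y * x); split.
- by rewrite unitrMl.
- by rewrite counitM x1 y1 mulr1.
- by rewrite coprodM invrM // tensM !mulrA.
Qed.

Lemma realizes_iff (J J' : H2) V W :
  twist J -> twist J' -> admissible_pair p V -> admissible_pair p W ->
  realizes J V -> realizes J' W -> gauge_equiv J J' <-> pair_equiv V W.
Proof.
move=> twJ twJ' admV admW JV J'W; split=> [JJ'|VW].
  exact: realizes_unique twJ admV admW JV (realizes_gauge JJ' J'W).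
exact: realizes_gauge_unique twJ twJ' admW (realizes_pair_equiv admW JV VW) J'W.
Qed.

End Correspondence.

(** The bijection sends a class to the set of the elements of A' that S relates
    to one of its members, so that no representatives are chosen. *)
Lemma classes_set_bij (T T' : Type) (A : set T) (R : T -> T -> Prop)
    (A' : set T') (R' : T' -> T' -> Prop) (S : T -> T' -> Prop) :
  (forall x, R x x) -> (forall x y, R x y -> R y x) ->
  (forall x y z, R x y -> R y z -> R x z) ->
  (forall x, A x -> exists2 y, A' y & S x y) ->
  (forall y, A' y -> exists2 x, A x & S x y) ->
  (forall x x' y y', A x -> A x' -> A' y -> A' y' -> S x y -> S x' y' ->
     R x x' <-> R' y y') ->
  exists f, set_bij (Defs.classes A R) (Defs.classes A' R') f.
Proof.
move=> Rxx Rsym Rtrans totS surjS SR.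
pose f (c : set T) : set T' :=
  [set y | A' y /\ exists x, [/\ A x, c x & S x y]]%classic.
have fE x y : A x -> A' y -> S x y ->
    f (A `&` [set z | R x z])%classic = (A' `&` [set z | R' y z])%classic.
  move=> Ax A'y Sxy; apply/seteqP.
  split=> [z [A'z [w [Aw [_ Rxw] Swz]]]|z [A'z R'yz]].
    by split=> //; apply/(SR x w y z).
  split=> //; have [w Aw Swz] := surjS z A'z.
  by exists w; split=> //; split=> //; apply/(SR x w y z).
exists f; split.
- move=> _ [x Ax <-]; have [y A'y Sxy] := totS x Ax.
  by rewrite (fE x y) //; exists y.
- move=> _ _ /set_mem[x Ax <-] /set_mem[x' Ax' <-].
  have [y A'y Sxy] := totS x Ax; have [y' A'y' Sxy'] := totS x' Ax'.
  rewrite (fE x y) // (fE x' y') // => eqc.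
  have : (A' `&` [set z | R' y z])%classic y'.
    by rewrite eqc; split=> //; apply/(SR x' x' y' y').
  move=> [_ /(SR x x' y y') Rxx']; have {}Rxx' := Rxx' Ax Ax' A'y A'y' Sxy Sxy'.
  apply/seteqP; split=> z [Az Rz]; split=> //=.
    exact: Rtrans (Rsym _ _ Rxx') Rz.
  exact: Rtrans Rxx' Rz.
- move=> _ [y A'y <-]; have [x Ax Sxy] := surjS y A'y.
  by exists (A `&` [set z | R x z])%classic; [exists x|apply: fE].
Qed.

Theorem theorem6p5 (k : closedFieldType) (p : nat) (hp : p \in [pchar k]%R)
    (gT : finGroupType) :
  exists f : set (grpalg k (gT * gT)%type) -> set (proj_pair k gT),
    set_bij (twist_classes k gT) (pair_classes k gT p) f.
Proof.
apply: (classes_set_bij (S := @realizes k gT)).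
- exact: gauge_equiv_refl.
- exact: gauge_equiv_sym.
- exact: gauge_equiv_trans.
- by move=> J twJ; apply: realizes_exists.
- by move=> V; apply: pair_realized.
- by move=> J J' V W twJ twJ' admV admW; apply: (realizes_iff hp).
Qed.
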